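(* Suppose that the assumption on $\alpha,\beta$, the diffusion-coefficient assumption on $\sigma$ (with $\sigma^2(q)=D(q)$ for $q\ge M$) and the initial-condition assumption on $\mathfrak{C}_0$, all given in the context, hold true. Denote by $\mathfrak{C}\in\mathcal{C}^\infty(\mathbb{R}_+\times\mathbb{R})$ the (unique classical, smooth and bounded) solution of $$\frac{\partial \mathfrak{C}}{\partial t} = \frac12\sigma^2(q)\frac{\partial^2\mathfrak{C}}{\partial q^2},\qquad \mathfrak{C}(0,q)=\mathfrak{C}_0(q).$$ Define $\mathscr{C}\in\mathcal{C}^\infty(Z_M)$ by $\mathscr{C}(t,x)=\mathfrak{C}(t,Q(t,x))$ for all $(t,x)\in Z_M$. Then $$\forall (t,x)\in Z_M,\qquad \frac{\partial\mathscr{C}}{\partial t}(t,x)=-\frac{\partial(F\mathscr{C})}{\partial x}(t,x)+\frac12\frac{\partial^2(D\mathscr{C})}{\partial x^2}(t,x)+R_{\mathfrak{C}}(t,x),$$ where there exists a non-negative function $K\in\mathcal{C}^0(\mathbb{R}_+)$ such that $$\forall (t,x)\in Z_M,\qquad |R_{\mathfrak{C}}(t,x)|\le K(t)\,x^{\gamma-1}.$$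
   Context: $\mathbb{R}_+=[0,+\infty)$. $C_1\ge 0$ is a fixed real number. Assumption on $\alpha,\beta$: $\alpha,\beta:\mathbb{R}_+\to\mathbb{R}_+$ are smooth, non-decreasing and non-negative. There exists $0\le\gamma\le1/2$ such that, as $x\to+\infty$, $\alpha^{(k)}(x)=\mathrm{O}(x^{\gamma-k})$ and $\beta^{(k)}(x)=\mathrm{O}(x^{\gamma-k})$ for all $k\in\{0,1,2\}$. Finally, there exist $M,K_+,K_->0$ (depending on $C_1$) such that, on $[M,+\infty)$, the function $F=\beta C_1-\alpha$ is positive and increasing, and $K_-x^\gamma\le F(x)\le K_+x^\gamma$ for all $x\ge M$. Notation: $F(x)=\beta(x)C_1-\alpha(x)$, $D(x)=\beta(x)C_1+\alpha(x)$. For $x\ge M$, $G(x)=\int_M^x \frac{dy}{F(y)}$; $G$ is an increasing bijection from $[M,+\infty)$ to $[0,+\infty)$ with inverse $G^{-1}:[0,+\infty)\to[M,+\infty)$. $Z_M=\{(t,x)\in\mathbb{R}_+\times[M,+\infty): t\le G(x)\}$ and $Q(t,x)=G^{-1}(G(x)-t)$ for $(t,x)\in Z_M$. Diffusion-coefficient assumption: $\sigma$ is a smooth positive function on $\mathbb{R}$ with bounded derivatives. Moreover $\sigma(q)=\sigma_0(q)\sigma_{\mathrm b}(q)$, where $\sigma_0(q)=|q|^{\gamma/2}$ for $|q|\ge1$ (here $\gamma\in[0,1/2]$ is the same exponent as the one for which $\alpha^{(k)}(x),\beta^{(k)}(x)=\mathrm{O}(x^{\gamma-k})$ for $k\in\{0,1,2\}$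 and $K_-x^\gamma\le F(x)\le K_+x^\gamma$ for $x\ge M$), and $\sigma_{\mathrm b}$ is a bounded smooth function with bounded derivatives for which there exist $\delta_-,\delta_+>0$ such that $\delta_-\le\sigma_{\mathrm b}\le\delta_+$. Finally, for any $n\ge1$ there exists $S_n\in\mathbb{R}_+$ such that $|\sigma^{(n)}(q)|\le S_n|q|^{\gamma/2-n}$ for $|q|\ge1$. The coefficient $\sigma$ satisfies $\sigma^2(q)=D(q)$ for all $q\ge M$. Initial-condition assumption: $\mathfrak{C}_0$ is a smooth bounded function on $\mathbb{R}$ and, for all $n\ge1$, there is $R_n\in\mathbb{R}_+$ with $\|\mathfrak{C}_0^{(n)}\sigma_0^n\|_{\mathcal{C}^0}\le R_n$ (supremum norm on $\mathbb{R}$). *)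

(* Defs.v *)
(* Written against the standard library reals and Coquelicot. *)
From Stdlib Require Import Reals.
From Coquelicot Require Import Coquelicot.
Open Scope R_scope.

(** A function on a subset of [R] or [R * R] is a total function whose values off
  the subset are never looked at.  Derivatives are taken relative to the subset
  [S], i.e. along the filter [within S (locally p)]; at an interior point these
  are the usual derivatives, and at a boundary point they are the one-sided
  ones.  The operators return the derivative through Coquelicot's definite
  description [iota], so they are meaningful only where the derivative exists
  and is unique.  Uniqueness holds at every point of the sets used here
  (half-line, half-plane, [Zdom]), because these are closures of their
  interiors with non-degenerate tangent cones. *)

Definition is_derive_on (S : R -> Prop) (f : R -> R) (x l : R) : Prop :=
  filterdiff f (within S (locally x)) (fun h : R => scal h l).

Definition Derive_on (S : R -> Prop) (f : R -> R) (x : R) : R :=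
  iota (fun l : R => is_derive_on S f x l).

Fixpoint Derive_n_on (S : R -> Prop) (f : R -> R) (n : nat) : R -> R :=
  match n with
  | O => f
  | Datatypes.S m => Derive_on S (Derive_n_on S f m)
  end.

Definition smooth_on (S : R -> Prop) (f : R -> R) : Prop :=
  forall (n : nat) (x : R), S x -> exists l, is_derive_on S (Derive_n_on S f n) x l.

Definition smooth (f : R -> R) : Prop :=
  forall (n : nat) (x : R), ex_derive_n f n x.

(** Points of [R * R] are pairs (time, space).  The derivatives in [t] and [x]
  are the two components of the differential relative to [S]: at the corner
  [(0, M)] of [Zdom] the time slice is a single point, so the time derivative
  cannot be defined slice by slice. *)

Definition is_differential_on (S : R * R -> Prop) (f : R * R -> R)
    (p : R * R) (lt lx : R) : Prop :=
  filterdiff f (within S (locally p)) (fun h : R * R => fst h * lt + snd h * lx).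

Definition partial_t (S : R * R -> Prop) (f : R * R -> R) (p : R * R) : R :=
  iota (fun lt : R => exists lx, is_differential_on S f p lt lx).

Definition partial_x (S : R * R -> Prop) (f : R * R -> R) (p : R * R) : R :=
  iota (fun lx : R => exists lt, is_differential_on S f p lt lx).

Fixpoint Ck2_on (k : nat) (S : R * R -> Prop) (f : R * R -> R) : Prop :=
  match k with
  | O => continuous_on S f
  | Datatypes.S m =>
      (forall p, S p -> exists lt lx, is_differential_on S f p lt lx)
      /\ Ck2_on m S (partial_t S f) /\ Ck2_on m S (partial_x S f)
  end.

Definition smooth2_on (S : R * R -> Prop) (f : R * R -> R) : Prop :=
  forall k : nat, Ck2_on k S f.

Definition Rplus_set (x : R) : Prop := 0 <= x.

Definition bigO_infty (f g : R -> R) : Prop :=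
  exists A : R, Rbar_locally p_infty (fun x => Rabs (f x) <= A * Rabs (g x)).

Definition Ffun (C1 : R) (alpha beta : R -> R) (x : R) : R :=
  beta x * C1 - alpha x.

Definition Dfun (C1 : R) (alpha beta : R -> R) (x : R) : R :=
  beta x * C1 + alpha x.

Definition rate_function (gamma : R) (a : R -> R) : Prop :=
  smooth_on Rplus_set a
  /\ (forall x, 0 <= x -> 0 <= a x)
  /\ (forall x y, 0 <= x -> x <= y -> a x <= a y)
  /\ (forall k : nat, (k <= 2)%nat ->
        bigO_infty (Derive_n_on Rplus_set a k)
          (fun x => Rpower x (gamma - INR k))).

Record rates_assumption (C1 : R) (alpha beta : R -> R) (gamma M : R) : Prop := {
  gamma_range : 0 <= gamma <= 1 / 2;
  alpha_rate : rate_function gamma alpha;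
  beta_rate : rate_function gamma beta;
  M_pos : 0 < M;
  F_pos : forall x, M <= x -> 0 < Ffun C1 alpha beta x;
  F_incr : forall x y, M <= x -> x < y ->
    Ffun C1 alpha beta x < Ffun C1 alpha beta y;
  F_growth : exists Kminus Kplus : R, 0 < Kminus /\ 0 < Kplus /\
    forall x, M <= x ->
      Kminus * Rpower x gamma <= Ffun C1 alpha beta x <= Kplus * Rpower x gamma
}.

Definition Gfun (F : R -> R) (M x : R) : R := RInt (fun y => / F y) M x.

Definition Ginv (F : R -> R) (M s : R) : R :=
  iota (fun x : R => M <= x /\ Gfun F M x = s).

Definition Zdom (F : R -> R) (M : R) (p : R * R) : Prop :=
  0 <= fst p /\ M <= snd p /\ fst p <= Gfun F M (snd p).

Definition Qfun (F : R -> R) (M : R) (p : R * R) : R :=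
  Ginv F M (Gfun F M (snd p) - fst p).

(** Since [sigma = sigma0 * sigmab] with [sigmab >= deltam > 0], the values of
  [sigma0] on [(-1, 1)] are determined by [sigma] and [sigmab]. *)
Record diffusion_assumption (gamma : R) (sigma sigma0 sigmab : R -> R) : Prop := {
  sigma_smooth : smooth sigma;
  sigma_pos : forall q, 0 < sigma q;
  sigma_bounded_derivatives : forall n : nat, (1 <= n)%nat ->
    exists B, forall q, Rabs (Derive_n sigma n q) <= B;
  sigma_factor : forall q, sigma q = sigma0 q * sigmab q;
  sigma0_power : forall q, 1 <= Rabs q -> sigma0 q = Rpower (Rabs q) (gamma / 2);
  sigmab_smooth : smooth sigmab;
  sigmab_bounded_derivatives : forall n : nat,
    exists B, forall q, Rabs (Derive_n sigmab n q) <= B;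
  sigmab_bounds : exists deltam deltap, 0 < deltam /\ 0 < deltap /\
    forall q, deltam <= sigmab q <= deltap;
  sigma_decay : forall n : nat, (1 <= n)%nat -> exists Sn, 0 <= Sn /\
    forall q, 1 <= Rabs q ->
      Rabs (Derive_n sigma n q) <= Sn * Rpower (Rabs q) (gamma / 2 - INR n)
}.

Record initial_assumption (sigma0 c0 : R -> R) : Prop := {
  c0_smooth : smooth c0;
  c0_bounded : exists B, forall q, Rabs (c0 q) <= B;
  c0_weighted : forall n : nat, (1 <= n)%nat -> exists Rn, 0 <= Rn /\
    forall q, Rabs (Derive_n c0 n q * sigma0 q ^ n) <= Rn
}.

Definition half_plane (p : R * R) : Prop := 0 <= fst p.

Record bounded_smooth_solution (sigma c0 : R -> R) (c : R * R -> R) : Prop := {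
  solution_smooth : smooth2_on half_plane c;
  solution_bounded : exists B, forall p, half_plane p -> Rabs (c p) <= B;
  solution_equation : forall p, half_plane p ->
    partial_t half_plane c p
    = 1 / 2 * sigma (snd p) ^ 2 * partial_x half_plane (partial_x half_plane c) p;
  solution_initial : forall q, c (0, q) = c0 q
}.

(* Main.v *)
Require Import Defs.
From Stdlib Require Import Reals Lra Lia ClassicalEpsilon Classical.
From Coquelicot Require Import Coquelicot.
Open Scope R_scope.

(** Write [Q = Q(t, x)], [r = Q_x = F(Q) / F(x)], and [C(t, x) = c(t, Q)].  Since
  [Q_t = - F(Q)], the transport terms cancel: [C_t + (F C)_x] equals
  [c_t + F'(x) C], and [c_t = D(Q) c_qq / 2] by the equation and the hypothesis
  [sigma ^ 2 = D] on [[M, +oo)].  Expanding [(D C)_xx] leaves the remainder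
<<
    F'(x) C - D''(x) C / 2 - D'(x) c_q r
    - (D(x) / F(x)) c_q r (F'(Q) - F'(x)) / 2 + c_qq (D(Q) - D(x) r^2) / 2
>>
  ([remainder_eq]).  It is of order [x ^ (gamma - 1)] for two reasons.

  First, along a characteristic of duration [t], [x - Q <= t F(x)] and
  [Q <= x <= Q exp (L t)] ([Q_distance], [Q_comparable]), so powers of [Q] and of
  [x] are comparable, and the increments of [F] and [D] over [[Q, x]] are of order
  [x ^ (2 gamma - 1)].

  Second, [c_q] is bounded and [c_qq] is of order [q ^ (- gamma)] on [[M, +oo)],
  uniformly in time.  A bounded solution carries no a priori control of its
  derivatives, so these bounds come from the minimum principle for bounded
  functions alone ([minimum_principle]): with [A] a bound on
  [sigma ^ 2 c0'' / 2], the functions [c0 + A t] and [c0 - A t] are barriers for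
  [c], hence [|c(h, .) - c0| <= A h]; the principle applied to
  [c(t + h, .) - c(t, .)] propagates this bound to all times, so [|c_t| <= A]
  ([time_derivative_bound]).  The equation then gives [|c_qq| <= 2 A / D], and
  Landau's interpolation between [c] and [c_qq] bounds [c_q]
  ([space_derivative_bound]).

  Smoothness of [C] on the domain, up to its boundary and its corner, rests on the
  chain rule for differentials relative to a set ([taylor_comp], [class_C_comp])
  and on the system [Q_t = - F(Q)], [Q_x = F(Q) / F(x)], which gains one
  derivative at each step ([class_C_Q]). *)

(** * Differentials relative to a subset of the plane *)

(** The l1 distance of the plane, equivalent to the norm of [R * R]. *)
Definition dist1 (p q : R * R) : R :=
  Rabs (fst q - fst p) + Rabs (snd q - snd p).

(** First-order Taylor expansion of [f] at [p] relative to [S]: the epsilon-delta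
  form of [is_differential_on]. *)
Definition taylor_on (S : R * R -> Prop) (f : R * R -> R) (p : R * R)
    (a b : R) : Prop :=
  forall eps, 0 < eps -> exists d, 0 < d /\ forall q, S q -> dist1 p q < d ->
    Rabs (f q - f p - ((fst q - fst p) * a + (snd q - snd p) * b))
    <= eps * dist1 p q.

(** Continuity at [p] of the restriction of [f] to [S]. *)
Definition cont_on (S : R * R -> Prop) (f : R * R -> R) (p : R * R) : Prop :=
  forall eps, 0 < eps -> exists d, 0 < d /\ forall q, S q -> dist1 p q < d ->
    Rabs (f q - f p) < eps.

Lemma dist1_pos p q : 0 <= dist1 p q.
Proof.
unfold dist1; generalize (Rabs_pos (fst q - fst p)) (Rabs_pos (snd q - snd p)).
lra.
Qed.

Lemma dist1_refl p : dist1 p p = 0.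
Proof. unfold dist1; rewrite !Rminus_diag, Rabs_R0; lra. Qed.

Lemma norm_dist1 (p q : R * R) :
  norm (minus q p) <= dist1 p q <= 2 * norm (minus q p).
Proof.
change (norm (minus q p))
  with (sqrt (Rabs (fst q - fst p) ^ 2 + Rabs (snd q - snd p) ^ 2)).
unfold dist1.
generalize (Rabs_pos (fst q - fst p)) (Rabs_pos (snd q - snd p)).
generalize (Rabs (fst q - fst p)) (Rabs (snd q - snd p)); intros a b Ha Hb.
split.
- rewrite <- (sqrt_pow2 (a + b)) by lra; apply sqrt_le_1_alt; nra.
- assert (a <= sqrt (a ^ 2 + b ^ 2)).
  { rewrite <- (sqrt_pow2 a) at 1 by lra; apply sqrt_le_1_alt; nra. }
  assert (b <= sqrt (a ^ 2 + b ^ 2)).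
  { rewrite <- (sqrt_pow2 b) at 1 by lra; apply sqrt_le_1_alt; nra. }
  lra.
Qed.

Lemma locally_dist1 (p : R * R) (P : R * R -> Prop) :
  locally p P <-> exists d, 0 < d /\ forall q, dist1 p q < d -> P q.
Proof.
split.
- intros [e He]; exists e; split; [apply cond_pos|].
  intros q Hq; apply He; unfold dist1 in Hq.
  generalize (Rabs_pos (fst q - fst p)) (Rabs_pos (snd q - snd p)); intros.
  split; unfold ball; simpl; unfold AbsRing_ball, abs, minus, plus, opp; simpl;
    unfold Rminus in *; lra.
- intros [d [Hd H]]; exists (mkposreal (d / 2) ltac:(lra)); intros q [H1 H2].
  apply H; unfold dist1.
  unfold ball in H1, H2; simpl in H1, H2;
    unfold AbsRing_ball, abs, minus, plus, opp in H1, H2; simpl in H1, H2.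
  unfold Rminus; lra.
Qed.

Lemma within_dist1 S (p : R * R) (P : R * R -> Prop) :
  within S (locally p) P
  <-> exists d, 0 < d /\ forall q, S q -> dist1 p q < d -> P q.
Proof.
unfold within; rewrite locally_dist1.
split; intros [d [Hd H]]; exists d; split; auto.
Qed.

Lemma continuous_on_dist1 S (f : R * R -> R) :
  continuous_on S f <-> forall p, S p -> cont_on S f p.
Proof.
split; intros H p Hp.
- intros eps Heps.
  assert (Hl : locally (f p) (fun y => Rabs (y - f p) < eps)).
  { exists (mkposreal eps Heps); intros y Hy; exact Hy. }
  destruct (proj1 (within_dist1 _ _ _) (H p Hp _ Hl)) as [d [Hd Hq]].
  exists d; split; auto.
- intros P [e He]; apply within_dist1.
  destruct (H p Hp e (cond_pos e)) as [d [Hd Hq]].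
  exists d; split; [exact Hd|]; intros q Sq Hdq; apply He.
  apply Hq; assumption.
Qed.

Lemma is_linear_form (a b : R) :
  is_linear (fun h : R * R => fst h * a + snd h * b).
Proof.
split.
- intros x y; unfold plus; simpl; unfold plus; simpl; ring.
- intros k x; unfold scal; simpl; unfold scal; simpl; unfold mult; simpl; ring.
- exists (Rabs a + Rabs b + 1).
  generalize (Rabs_pos a) (Rabs_pos b); intros Ha Hb; split; [lra|].
  intros x.
  change (norm (fst x * a + snd x * b)) with (Rabs (fst x * a + snd x * b)).
  assert (Hx1 : Rabs (fst x) <= norm x).
  { change (norm x) with (sqrt (Rabs (fst x) ^ 2 + Rabs (snd x) ^ 2)).
    rewrite <- (sqrt_pow2 (Rabs (fst x))) at 1 by apply Rabs_pos.
    apply sqrt_le_1_alt; generalize (Rabs_pos (snd x)); nra. }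
  assert (Hx2 : Rabs (snd x) <= norm x).
  { change (norm x) with (sqrt (Rabs (fst x) ^ 2 + Rabs (snd x) ^ 2)).
    rewrite <- (sqrt_pow2 (Rabs (snd x))) at 1 by apply Rabs_pos.
    apply sqrt_le_1_alt; generalize (Rabs_pos (fst x)); nra. }
  apply Rle_trans with (1 := Rabs_triang _ _); rewrite !Rabs_mult.
  generalize (Rabs_pos (fst x)) (Rabs_pos (snd x)); intros; nra.
Qed.

(** The hypothesis [S p] makes [p] the limit point of the filter
  [within S (locally p)]; outside the closure of [S], every linear form is a
  differential. *)
Lemma differential_taylor S f p a b : S p ->
  is_differential_on S f p a b <-> taylor_on S f p a b.
Proof.
intros Sp; split.
- intros [_ H] eps Heps.
  assert (Hl : is_filter_lim (within S (locally p)) p).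
  { intros P HP; unfold within; apply filter_imp with (2 := HP); auto. }
  specialize (H p Hl (mkposreal eps Heps)).
  destruct (proj1 (within_dist1 _ _ _) H) as [d [Hd Hq]].
  exists d; split; [exact Hd|]; intros q Sq Hdq.
  specialize (Hq q Sq Hdq); cbv beta in Hq; simpl pos in Hq.
  apply Rle_trans with (1 := Hq).
  apply Rmult_le_compat_l; [lra|]; apply norm_dist1.
- intros H; split; [apply is_linear_form|].
  intros x Hx eps.
  assert (x = p).
  { destruct p as [t0 x0], x as [t1 x1].
    (* the limit point of the filter is [p] since every neighbourhood of the
       limit point contains [p] *)
    assert (Hp : forall d, 0 < d -> dist1 (t1, x1) (t0, x0) < d).
    { intros d Hd.
      assert (HL : locally (t1, x1) (fun q => dist1 (t1, x1) q < d)).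
      { apply locally_dist1; exists d; split; auto. }
      destruct (proj1 (within_dist1 _ _ _) (Hx _ HL)) as [e [He Hq]].
      apply Hq; [exact Sp|]; rewrite dist1_refl; exact He. }
    assert (Hd0 : dist1 (t1, x1) (t0, x0) = 0).
    { destruct (Req_dec (dist1 (t1, x1) (t0, x0)) 0) as [E|E]; [exact E|].
      generalize (dist1_pos (t1, x1) (t0, x0)); intros.
      generalize (Hp (dist1 (t1, x1) (t0, x0)) ltac:(lra)); lra. }
    unfold dist1 in Hd0; simpl in Hd0.
    generalize (Rabs_pos (t0 - t1)) (Rabs_pos (x0 - x1)); intros.
    assert (t0 - t1 = 0).
    { destruct (Req_dec (t0 - t1) 0) as [E|E]; auto.
      generalize (Rabs_pos_lt _ E); lra. }
    assert (x0 - x1 = 0).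
    { destruct (Req_dec (x0 - x1) 0) as [E|E]; auto.
      generalize (Rabs_pos_lt _ E); lra. }
    f_equal; lra. }
  subst x.
  destruct (H (eps / 2)) as [d [Hd Hq]]; [generalize (cond_pos eps); lra|].
  apply within_dist1; exists d; split; [exact Hd|]; intros q Sq Hdq.
  specialize (Hq q Sq Hdq).
  apply Rle_trans with (1 := Hq).
  destruct eps as [e He]; simpl.
  generalize (proj2 (norm_dist1 p q)); intros Hn; simpl in Hn.
  set (N := norm (minus q p)) in Hn.
  apply Rle_trans with (e / 2 * (2 * N)); [apply Rmult_le_compat_l; [lra|exact Hn]|].
  change (e / 2 * (2 * N) <= e * N); lra.
Qed.

Lemma taylor_ext S f g p a b : S p -> (forall q, S q -> f q = g q) ->
  taylor_on S f p a b -> taylor_on S g p a b.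
Proof.
intros Sp E H eps He; destruct (H eps He) as [d [Hd Hq]].
exists d; split; [exact Hd|]; intros q Sq Hdq; rewrite <- !E; auto.
Qed.

Lemma taylor_Lipschitz S f p a b : taylor_on S f p a b ->
  exists L d, 0 < L /\ 0 < d /\ forall q, S q -> dist1 p q < d ->
    Rabs (f q - f p) <= L * dist1 p q.
Proof.
intros H; destruct (H 1 Rlt_0_1) as [d [Hd Hq]].
exists (1 + Rabs a + Rabs b), d.
generalize (Rabs_pos a) (Rabs_pos b); intros; split; [lra|]; split; [lra|].
intros q Sq Hdq; specialize (Hq q Sq Hdq).
set (l := (fst q - fst p) * a + (snd q - snd p) * b) in *.
assert (Rabs l <= (Rabs a + Rabs b) * dist1 p q).
{ unfold l; apply Rle_trans with (1 := Rabs_triang _ _); rewrite !Rabs_mult.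
  unfold dist1.
  generalize (Rabs_pos (fst q - fst p)) (Rabs_pos (snd q - snd p)); intros; nra. }
replace (f q - f p) with ((f q - f p - l) + l) by ring.
apply Rle_trans with (1 := Rabs_triang _ _); lra.
Qed.

Lemma taylor_cont S f p a b : taylor_on S f p a b -> cont_on S f p.
Proof.
intros H eps He; destruct (taylor_Lipschitz _ _ _ _ _ H) as (L & d & HL & Hd & Hq).
exists (Rmin d (eps / L)); split.
- apply Rmin_glb_lt; [exact Hd|]; apply Rdiv_lt_0_compat; lra.
- intros q Sq Hdq.
  assert (dist1 p q < d) by (generalize (Rmin_l d (eps / L)); lra).
  assert (H2 : dist1 p q < eps / L) by (generalize (Rmin_r d (eps / L)); lra).
  apply Rle_lt_trans with (1 := Hq q Sq H0).
  apply Rmult_lt_compat_l with (r := L) in H2; [|exact HL].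
  replace (L * (eps / L)) with eps in H2 by (field; lra); lra.
Qed.

(** Chain rule for a function on [T] composed with a map from [S] to [T]. *)
Lemma taylor_comp S T f g1 g2 p a b a1 b1 a2 b2 :
  (forall q, S q -> T (g1 q, g2 q)) ->
  taylor_on T f (g1 p, g2 p) a b ->
  taylor_on S g1 p a1 b1 -> taylor_on S g2 p a2 b2 ->
  taylor_on S (fun q => f (g1 q, g2 q)) p (a * a1 + b * a2) (a * b1 + b * b2).
Proof.
intros HT Hf H1 H2 eps He.
destruct (taylor_Lipschitz _ _ _ _ _ H1) as (L1 & d1 & HL1 & Hd1 & Hq1).
destruct (taylor_Lipschitz _ _ _ _ _ H2) as (L2 & d2 & HL2 & Hd2 & Hq2).
destruct (Hf (eps / 2 / (L1 + L2))) as (d & Hd & Hq).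
{ apply Rdiv_lt_0_compat; lra. }
set (e := eps / 2 / (1 + Rabs a + Rabs b)).
assert (HB : 0 < 1 + Rabs a + Rabs b)
  by (generalize (Rabs_pos a) (Rabs_pos b); lra).
assert (He' : 0 < e) by (apply Rdiv_lt_0_compat; lra).
destruct (H1 e He') as (d1' & Hd1' & Hq1').
destruct (H2 e He') as (d2' & Hd2' & Hq2').
set (dd := d / (L1 + L2)).
assert (Hdd : 0 < dd) by (apply Rdiv_lt_0_compat; lra).
exists (Rmin (Rmin d1 d2) (Rmin dd (Rmin d1' d2'))).
split; [repeat apply Rmin_glb_lt; assumption|].
intros q Sq Hdq.
generalize (Rmin_l (Rmin d1 d2) (Rmin dd (Rmin d1' d2')))
  (Rmin_r (Rmin d1 d2) (Rmin dd (Rmin d1' d2'))) (Rmin_l d1 d2) (Rmin_r d1 d2)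
  (Rmin_l dd (Rmin d1' d2')) (Rmin_r dd (Rmin d1' d2'))
  (Rmin_l d1' d2') (Rmin_r d1' d2'); intros.
specialize (Hq1 q Sq ltac:(lra)); specialize (Hq2 q Sq ltac:(lra)).
specialize (Hq1' q Sq ltac:(lra)); specialize (Hq2' q Sq ltac:(lra)).
assert (Hg : dist1 (g1 p, g2 p) (g1 q, g2 q) <= (L1 + L2) * dist1 p q).
{ unfold dist1 at 1; simpl; lra. }
specialize (Hq _ (HT q Sq)).
assert (HD : dist1 (g1 p, g2 p) (g1 q, g2 q) < d).
{ apply Rle_lt_trans with (1 := Hg).
  apply Rlt_le_trans with ((L1 + L2) * dd); [apply Rmult_lt_compat_l; lra|].
  unfold dd; right; field; lra. }
specialize (Hq HD); simpl in Hq.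
set (D := dist1 p q) in *.
assert (HD0 : 0 <= D) by apply dist1_pos.
assert (Hf' : eps / 2 / (L1 + L2) * dist1 (g1 p, g2 p) (g1 q, g2 q) <= eps / 2 * D).
{ apply Rle_trans with (eps / 2 / (L1 + L2) * ((L1 + L2) * D)).
  - apply Rmult_le_compat_l; [|exact Hg].
    apply Rlt_le, Rdiv_lt_0_compat; lra.
  - right; field; lra. }
set (l1 := (fst q - fst p) * a1 + (snd q - snd p) * b1) in *.
set (l2 := (fst q - fst p) * a2 + (snd q - snd p) * b2) in *.
replace (f (g1 q, g2 q) - f (g1 p, g2 p) -
  ((fst q - fst p) * (a * a1 + b * a2) + (snd q - snd p) * (a * b1 + b * b2)))
 with ((f (g1 q, g2 q) - f (g1 p, g2 p) - ((g1 q - g1 p) * a + (g2 q - g2 p) * b))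
   + (a * (g1 q - g1 p - l1) + b * (g2 q - g2 p - l2))) by (unfold l1, l2; ring).
apply Rle_trans with (1 := Rabs_triang _ _).
assert (Rabs (a * (g1 q - g1 p - l1) + b * (g2 q - g2 p - l2))
  <= (Rabs a + Rabs b) * (e * D)).
{ apply Rle_trans with (1 := Rabs_triang _ _); rewrite !Rabs_mult.
  generalize (Rabs_pos a) (Rabs_pos b); intros; nra. }
assert ((Rabs a + Rabs b) * (e * D) <= eps / 2 * D).
{ replace (eps / 2 * D) with ((1 + Rabs a + Rabs b) * (e * D))
    by (unfold e; field; lra).
  apply Rmult_le_compat_r; [apply Rmult_le_pos|]; lra. }
lra.
Qed.

Lemma taylor_fst S p : taylor_on S fst p 1 0.
Proof.
intros eps He; exists 1; split; [lra|]; intros q _ _.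
replace (fst q - fst p - ((fst q - fst p) * 1 + (snd q - snd p) * 0)) with 0 by ring.
rewrite Rabs_R0; apply Rmult_le_pos; [lra|apply dist1_pos].
Qed.

Lemma taylor_snd S p : taylor_on S snd p 0 1.
Proof.
intros eps He; exists 1; split; [lra|]; intros q _ _.
replace (snd q - snd p - ((fst q - fst p) * 0 + (snd q - snd p) * 1)) with 0 by ring.
rewrite Rabs_R0; apply Rmult_le_pos; [lra|apply dist1_pos].
Qed.

Lemma taylor_const S k p : taylor_on S (fun _ => k) p 0 0.
Proof.
intros eps He; exists 1; split; [lra|]; intros q _ _.
replace (k - k - _) with 0 by ring.
rewrite Rabs_R0; apply Rmult_le_pos; [lra|apply dist1_pos].
Qed.

Lemma taylor_add p : taylor_on (fun _ => True) (fun z => fst z + snd z) p 1 1.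
Proof.
intros eps He; exists 1; split; [lra|]; intros q _ _.
replace (fst q + snd q - (fst p + snd p) - _) with 0 by ring.
rewrite Rabs_R0; apply Rmult_le_pos; [lra|apply dist1_pos].
Qed.

Lemma taylor_prod p :
  taylor_on (fun _ => True) (fun z => fst z * snd z) p (snd p) (fst p).
Proof.
intros eps He; exists eps; split; [lra|]; intros q _ Hd.
replace (fst q * snd q - fst p * snd p - _)
  with ((fst q - fst p) * (snd q - snd p)) by ring.
rewrite Rabs_mult; generalize (dist1_pos p q); unfold dist1 in *.
generalize (Rabs_pos (fst q - fst p)) (Rabs_pos (snd q - snd p)); intros; nra.
Qed.

Lemma taylor_plus S f g p a b a' b' :
  taylor_on S f p a b -> taylor_on S g p a' b' ->
  taylor_on S (fun q => f q + g q) p (a + a') (b + b').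
Proof.
intros Hf Hg.
replace (a + a') with (1 * a + 1 * a') by ring.
replace (b + b') with (1 * b + 1 * b') by ring.
exact (taylor_comp S _ _ f g p _ _ _ _ _ _ (fun _ _ => I)
  (taylor_add (f p, g p)) Hf Hg).
Qed.

Lemma taylor_mult S f g p a b a' b' :
  taylor_on S f p a b -> taylor_on S g p a' b' ->
  taylor_on S (fun q => f q * g q) p (g p * a + f p * a') (g p * b + f p * b').
Proof.
intros Hf Hg.
exact (taylor_comp S _ _ f g p _ _ _ _ _ _ (fun _ _ => I)
  (taylor_prod (f p, g p)) Hf Hg).
Qed.

Lemma is_derive_eps (f : R -> R) (x l : R) : is_derive f x l <->
  forall eps, 0 < eps -> exists d, 0 < d /\ forall y, Rabs (y - x) < d ->
    Rabs (f y - f x - (y - x) * l) <= eps * Rabs (y - x).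
Proof.
rewrite is_derive_Reals; split.
- intros H eps He; destruct (H eps He) as [d Hd]; exists d; split; [apply cond_pos|].
  intros y Hy; destruct (Req_dec y x) as [->|E].
  { rewrite !Rminus_diag, Rmult_0_l, Rminus_0_r, Rabs_R0; lra. }
  specialize (Hd (y - x) ltac:(lra) Hy).
  replace (x + (y - x)) with y in Hd by ring.
  replace (f y - f x - (y - x) * l) with (((f y - f x) / (y - x) - l) * (y - x))
    by (field; lra).
  rewrite Rabs_mult; apply Rmult_le_compat_r; [apply Rabs_pos|lra].
- intros H eps He; destruct (H (eps / 2)) as [d [Hd Hy]]; [lra|].
  exists (mkposreal d Hd); intros h Hh Hhd; simpl in Hhd.
  specialize (Hy (x + h)); replace (x + h - x) with h in Hy by ring.
  specialize (Hy Hhd).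
  replace ((f (x + h) - f x) / h - l) with ((f (x + h) - f x - h * l) / h)
    by (field; lra).
  rewrite Rabs_div by assumption.
  apply Rle_lt_trans with (eps / 2); [|lra].
  apply Rle_div_l; [apply Rabs_pos_lt; assumption|exact Hy].
Qed.

Lemma taylor_of_derive T (f : R -> R) (p : R * R) (l : R) : is_derive f (fst p) l ->
  taylor_on T (fun q => f (fst q)) p l 0.
Proof.
intros H eps He; destruct (proj1 (is_derive_eps _ _ _) H eps He) as [d [Hd Hy]].
exists d; split; [exact Hd|]; intros q _ Hq; unfold dist1 in *.
generalize (Rabs_pos (snd q - snd p)); intros.
rewrite Rmult_0_r, Rplus_0_r.
apply Rle_trans with (1 := Hy (fst q) ltac:(lra)).
apply Rmult_le_compat_l; lra.
Qed.

(** Chain rule for a function of one variable composed with a function on [S]. *)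
Lemma taylor_comp1 S (f : R -> R) g p (l a b : R) : is_derive f (g p) l ->
  taylor_on S g p a b -> taylor_on S (fun q => f (g q)) p (l * a) (l * b).
Proof.
intros Hf Hg.
generalize (taylor_comp S _ _ g (fun _ => 0) p _ _ _ _ _ _ (fun _ _ => I)
  (taylor_of_derive (fun _ => True) f (g p, 0) l Hf) Hg (taylor_const S 0 p)).
simpl; rewrite !Rmult_0_l, !Rplus_0_r; auto.
Qed.

Lemma derive_slice_x (S : R * R -> Prop) f (t x a b : R) : (forall y, S (t, y)) ->
  taylor_on S f (t, x) a b -> is_derive (fun y => f (t, y)) x b.
Proof.
intros HS H; apply is_derive_eps; intros eps He.
destruct (H eps He) as [d [Hd Hq]]; exists d; split; [exact Hd|].
intros y Hy; specialize (Hq (t, y) (HS y)); unfold dist1 in Hq; simpl in Hq.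
rewrite Rminus_diag, Rabs_R0, Rplus_0_l, Rmult_0_l, Rplus_0_l in Hq; auto.
Qed.

Lemma derive_slice_t (S : R * R -> Prop) f (t x a b : R) :
  (exists e, 0 < e /\ forall s, Rabs (s - t) < e -> S (s, x)) ->
  taylor_on S f (t, x) a b -> is_derive (fun s => f (s, x)) t a.
Proof.
intros [e [He HS]] H; apply is_derive_eps; intros eps Heps.
destruct (H eps Heps) as [d [Hd Hq]]; exists (Rmin d e).
split; [apply Rmin_glb_lt; assumption|].
intros y Hy; generalize (Rmin_l d e) (Rmin_r d e); intros.
specialize (Hq (y, x) (HS y ltac:(lra))); unfold dist1 in Hq; simpl in Hq.
rewrite Rminus_diag, Rabs_R0, Rplus_0_r, Rmult_0_l, Rplus_0_r in Hq.
apply Hq; lra.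
Qed.

(** * Sets on which differentials are unique *)

(** At every point, [S] contains a segment in the direction [(0, 1)] and one in
  a direction [(1, k)]; two linear forms that agree on these are equal. *)
Definition two_directions (S : R * R -> Prop) : Prop :=
  forall t x, S (t, x) -> exists k d, 0 < d /\ forall s, 0 <= s <= d ->
    S (t, x + s) /\ S (t + s, x + k * s).

(** The difference quotients of [f] along a segment of [S] issued from [(t, x)]
  in the direction [(u, v)] tend to [u * a + v * b]. *)
Lemma taylor_direction S f t x a b u v d : 0 < d ->
  (forall s, 0 <= s <= d -> S (t + u * s, x + v * s)) ->
  taylor_on S f (t, x) a b ->
  forall eps, 0 < eps -> exists e, 0 < e /\ forall s, 0 < s <= e ->
    Rabs ((f (t + u * s, x + v * s) - f (t, x)) / s - (u * a + v * b)) <= eps.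
Proof.
intros Hd HS H eps He.
set (N := 1 + Rabs u + Rabs v).
assert (HN : 0 < N) by (unfold N; generalize (Rabs_pos u) (Rabs_pos v); lra).
destruct (H (eps / N)) as [d1 [Hd1 Hq]]; [apply Rdiv_lt_0_compat; lra|].
exists (Rmin d (d1 / (2 * N))); split.
{ apply Rmin_glb_lt; [lra|apply Rdiv_lt_0_compat; lra]. }
intros s [Hs1 Hs2].
generalize (Rmin_l d (d1 / (2 * N))) (Rmin_r d (d1 / (2 * N))); intros.
specialize (Hq _ (HS s ltac:(lra))).
assert (Hdist : dist1 (t, x) (t + u * s, x + v * s) <= N * s).
{ unfold dist1; simpl.
  replace (t + u * s - t) with (u * s) by ring.
  replace (x + v * s - x) with (v * s) by ring.
  rewrite !Rabs_mult, !(Rabs_pos_eq s) by lra; unfold N; nra. }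
assert (N * s < d1).
{ apply Rle_lt_trans with (N * (d1 / (2 * N))).
  - apply Rmult_le_compat_l; lra.
  - replace (N * (d1 / (2 * N))) with (d1 / 2) by (field; lra); lra. }
specialize (Hq ltac:(lra)); simpl in Hq.
replace (t + u * s - t) with (u * s) in Hq by ring.
replace (x + v * s - x) with (v * s) in Hq by ring.
replace ((f (t + u * s, x + v * s) - f (t, x)) / s - (u * a + v * b))
  with ((f (t + u * s, x + v * s) - f (t, x) - (u * s * a + v * s * b)) / s)
  by (field; lra).
rewrite Rabs_div, (Rabs_pos_eq s) by lra.
apply Rle_div_l; [lra|].
apply Rle_trans with (1 := Hq).
apply Rle_trans with (eps / N * (N * s)).
- apply Rmult_le_compat_l; [|exact Hdist]; apply Rlt_le, Rdiv_lt_0_compat; lra.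
- right; field; lra.
Qed.

Lemma taylor_unique S f p a b a' b' : two_directions S -> S p ->
  taylor_on S f p a b -> taylor_on S f p a' b' -> a = a' /\ b = b'.
Proof.
destruct p as [t x]; intros H2 Sp H H'.
destruct (H2 t x Sp) as (k & d & Hd & Hs).
assert (K : forall u v, (forall s, 0 <= s <= d -> S (t + u * s, x + v * s)) ->
  u * a + v * b = u * a' + v * b').
{ intros u v Huv.
  destruct (Req_dec (u * a + v * b) (u * a' + v * b')) as [E|E]; [exact E|].
  set (g := Rabs ((u * a + v * b) - (u * a' + v * b'))).
  assert (Hg : 0 < g) by (apply Rabs_pos_lt; lra).
  destruct (taylor_direction _ _ _ _ _ _ _ _ _ Hd Huv H (g / 3) ltac:(lra))
    as (e & He & Q).
  destruct (taylor_direction _ _ _ _ _ _ _ _ _ Hd Huv H' (g / 3) ltac:(lra))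
    as (e' & He' & Q').
  generalize (Rmin_l e e') (Rmin_r e e') (Rmin_glb_lt _ _ _ He He'); intros.
  specialize (Q (Rmin e e') ltac:(lra)); specialize (Q' (Rmin e e') ltac:(lra)).
  set (w := (f (t + u * Rmin e e', x + v * Rmin e e') - f (t, x)) / Rmin e e') in *.
  assert (g <= Rabs (w - (u * a' + v * b')) + Rabs (w - (u * a + v * b))).
  { unfold g; rewrite (Rabs_minus_sym w (u * a + v * b)).
    replace (u * a + v * b - (u * a' + v * b'))
      with ((w - (u * a' + v * b')) + (u * a + v * b - w)) by ring.
    apply Rabs_triang. }
  lra. }
assert (E1 : b = b').
{ assert (E := K 0 1).
  cut (0 * a + 1 * b = 0 * a' + 1 * b'); [lra|apply E].
  intros s Hs'; rewrite Rmult_0_l, Rplus_0_r, Rmult_1_l; apply Hs, Hs'. }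
split; [|exact E1].
cut (1 * a + k * b = 1 * a' + k * b'); [subst b'; lra|apply K].
intros s Hs'; rewrite Rmult_1_l; apply Hs, Hs'.
Qed.

Section Partials.
Variable S : R * R -> Prop.
Hypothesis HS : two_directions S.

Lemma partial_t_eq f p a b : S p -> taylor_on S f p a b -> partial_t S f p = a.
Proof.
intros Sp H; apply (@iota_unique R_AbsRing R_CompleteNormedModule).
- intros y [lx Hy]; apply differential_taylor in Hy; [|exact Sp].
  apply (taylor_unique S f p y lx a b); assumption.
- exists b; apply differential_taylor; assumption.
Qed.

Lemma partial_x_eq f p a b : S p -> taylor_on S f p a b -> partial_x S f p = b.
Proof.
intros Sp H; apply (@iota_unique R_AbsRing R_CompleteNormedModule).
- intros y [lx Hy]; apply differential_taylor in Hy; [|exact Sp].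
  apply (taylor_unique S f p lx y a b); assumption.
- exists a; apply differential_taylor; assumption.
Qed.

End Partials.

(** * The algebra of functions of class [C^k] on a subset *)

(** [class_C k S f]: the same notion as [Ck2_on k S f], with the partial
  derivatives given by witnesses instead of a definite description. *)
Fixpoint class_C (k : nat) (S : R * R -> Prop) (f : R * R -> R) : Prop :=
  match k with
  | O => forall p, S p -> cont_on S f p
  | Datatypes.S m => exists ft fx,
      (forall p, S p -> taylor_on S f p (ft p) (fx p))
      /\ class_C m S ft /\ class_C m S fx
  end.

Lemma class_C_ext k S : forall f g, (forall p, S p -> f p = g p) ->
  class_C k S f -> class_C k S g.
Proof.
destruct k as [|k]; simpl; intros f g E.
- intros H p Sp eps He; destruct (H p Sp eps He) as [d [Hd Hq]].
  exists d; split; [exact Hd|]; intros q Sq; rewrite <- !E; auto.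
- intros (ft & fx & H & H1 & H2); exists ft, fx; split; [|split; assumption].
  intros p Sp; apply taylor_ext with f; auto.
Qed.

Lemma class_C_Ck2 k S : two_directions S -> forall f,
  class_C k S f -> Ck2_on k S f.
Proof.
intros HS; induction k as [|k IH]; simpl; intros f.
- intros H; apply continuous_on_dist1; exact H.
- intros (ft & fx & H & H1 & H2); split; [|split].
  + intros p Sp; exists (ft p), (fx p); apply differential_taylor; auto.
  + apply IH, class_C_ext with ft; [|exact H1].
    intros p Sp; symmetry; apply partial_t_eq with (fx p); auto.
  + apply IH, class_C_ext with fx; [|exact H2].
    intros p Sp; symmetry; apply partial_x_eq with (ft p); auto.
Qed.

Lemma Ck2_taylor k S f p : two_directions S -> S p -> Ck2_on (Datatypes.S k) S f ->
  taylor_on S f p (partial_t S f p) (partial_x S f p).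
Proof.
intros HS Sp [H _]; destruct (H p Sp) as (a & b & Hab).
apply differential_taylor in Hab; [|exact Sp].
rewrite (partial_t_eq S HS f p a b Sp Hab), (partial_x_eq S HS f p a b Sp Hab).
exact Hab.
Qed.

Lemma Ck2_class_C k S : two_directions S -> forall f,
  Ck2_on k S f -> class_C k S f.
Proof.
intros HS; induction k as [|k IH]; intros f H.
- simpl; apply continuous_on_dist1; exact H.
- exists (partial_t S f), (partial_x S f); split; [|split; apply IH, H].
  intros p Sp; apply Ck2_taylor with k; assumption.
Qed.

Lemma class_C_pred k S : forall f, class_C (Datatypes.S k) S f -> class_C k S f.
Proof.
induction k as [|k IH]; intros f (ft & fx & H & H1 & H2).
- intros p Sp; apply taylor_cont with (ft p) (fx p); auto.
- exists ft, fx; auto.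
Qed.

Lemma class_C_const k S r : class_C k S (fun _ => r).
Proof.
revert r; induction k as [|k IH]; intros r.
- intros p _; exact (taylor_cont _ _ _ _ _ (taylor_const S r p)).
- exists (fun _ => 0), (fun _ => 0); split; [|split; apply IH].
  intros p _; apply taylor_const.
Qed.

Lemma class_C_fst k S : class_C k S fst.
Proof.
destruct k as [|k].
- intros p _; exact (taylor_cont _ _ _ _ _ (taylor_fst S p)).
- exists (fun _ => 1), (fun _ => 0); split; [|split; apply class_C_const].
  intros p _; apply taylor_fst.
Qed.

Lemma class_C_snd k S : class_C k S snd.
Proof.
destruct k as [|k].
- intros p _; exact (taylor_cont _ _ _ _ _ (taylor_snd S p)).
- exists (fun _ => 0), (fun _ => 1); split; [|split; apply class_C_const].
  intros p _; apply taylor_snd.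
Qed.

Lemma cont_comp S T f g1 g2 p : (forall q, S q -> T (g1 q, g2 q)) ->
  cont_on T f (g1 p, g2 p) -> cont_on S g1 p -> cont_on S g2 p ->
  cont_on S (fun q => f (g1 q, g2 q)) p.
Proof.
intros HT Hf H1 H2 eps He; destruct (Hf eps He) as (d & Hd & Hq).
destruct (H1 (d / 2)) as (d1 & Hd1 & Hq1); [lra|].
destruct (H2 (d / 2)) as (d2 & Hd2 & Hq2); [lra|].
exists (Rmin d1 d2); split; [apply Rmin_glb_lt; assumption|].
intros q Sq Hdq; generalize (Rmin_l d1 d2) (Rmin_r d1 d2); intros.
apply Hq; [apply HT, Sq|]; unfold dist1; simpl.
specialize (Hq1 q Sq ltac:(lra)); specialize (Hq2 q Sq ltac:(lra)); lra.
Qed.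

Lemma class_C_plus k S : forall f g, class_C k S f -> class_C k S g ->
  class_C k S (fun q => f q + g q).
Proof.
induction k as [|k IH]; intros f g.
- intros Hf Hg p Sp.
  exact (cont_comp S _ _ f g p (fun _ _ => I)
    (taylor_cont _ _ _ _ _ (taylor_add (f p, g p))) (Hf p Sp) (Hg p Sp)).
- intros (ft & fx & H & H1 & H2) (gt & gx & H' & H1' & H2').
  exists (fun p => ft p + gt p), (fun p => fx p + gx p); split; [|split; apply IH; auto].
  intros p Sp; apply taylor_plus; auto.
Qed.

Lemma class_C_mult k S : forall f g, class_C k S f -> class_C k S g ->
  class_C k S (fun q => f q * g q).
Proof.
induction k as [|k IH]; intros f g.
- intros Hf Hg p Sp.
  exact (cont_comp S _ _ f g p (fun _ _ => I)
    (taylor_cont _ _ _ _ _ (taylor_prod (f p, g p))) (Hf p Sp) (Hg p Sp)).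
- intros Cf Cg.
  generalize (class_C_pred _ _ _ Cf) (class_C_pred _ _ _ Cg); intros Cf' Cg'.
  destruct Cf as (ft & fx & H & H1 & H2), Cg as (gt & gx & H' & H1' & H2').
  exists (fun p => g p * ft p + f p * gt p), (fun p => g p * fx p + f p * gx p).
  split; [|split; apply class_C_plus; apply IH; auto].
  intros p Sp; apply taylor_mult; auto.
Qed.

(** The partial derivatives of the composite are sums of products of composites of
  lower class. *)
Lemma class_C_comp k S T g1 g2 : (forall q, S q -> T (g1 q, g2 q)) ->
  class_C k S g1 -> class_C k S g2 -> forall f, class_C k T f ->
  class_C k S (fun q => f (g1 q, g2 q)).
Proof.
intros HT; induction k as [|k IH]; intros C1 C2 f Cf.
- intros p Sp; apply cont_comp with T; auto.
- generalize (class_C_pred _ _ _ C1) (class_C_pred _ _ _ C2); intros C1' C2'.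
  destruct C1 as (gt1 & gx1 & H1 & H1t & H1x), C2 as (gt2 & gx2 & H2 & H2t & H2x).
  destruct Cf as (ft & fx & Hf & Hft & Hfx).
  exists (fun p => ft (g1 p, g2 p) * gt1 p + fx (g1 p, g2 p) * gt2 p),
         (fun p => ft (g1 p, g2 p) * gx1 p + fx (g1 p, g2 p) * gx2 p).
  split; [|split; apply class_C_plus; apply class_C_mult; auto].
  intros p Sp; apply taylor_comp with T; auto.
Qed.

(** [f n] is the [n]-th derivative of [f 0] on [(0, +oo)]. *)
Definition derivatives_pos (f : nat -> R -> R) : Prop :=
  forall n x, 0 < x -> is_derive (f n) x (f (Datatypes.S n) x).

Lemma class_C_comp1 k S f g : derivatives_pos f -> (forall p, S p -> 0 < g p) ->
  class_C k S g -> forall n, class_C k S (fun p => f n (g p)).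
Proof.
intros Hf Hg; induction k as [|k IH]; intros Cg n.
- intros p Sp.
  refine (cont_comp S _ (fun q => f n (fst q)) g (fun _ => 0) p (fun _ _ => I)
    (taylor_cont _ _ _ _ _ (taylor_of_derive (fun _ => True) (f n) (g p, 0) _
       (Hf n _ (Hg p Sp)))) (Cg p Sp) (taylor_cont _ _ _ _ _ (taylor_const S 0 p))).
- generalize (class_C_pred _ _ _ Cg); intros Cg'.
  destruct Cg as (gt & gx & H & H1 & H2).
  exists (fun p => f (Datatypes.S n) (g p) * gt p),
         (fun p => f (Datatypes.S n) (g p) * gx p).
  split; [|split; apply class_C_mult; auto].
  intros p Sp; apply taylor_comp1; auto.
Qed.

(** [1 / g] has the partial derivatives of [g] multiplied by [- (1 / g) ^ 2]. *)
Lemma class_C_inv k S g : (forall p, S p -> 0 < g p) ->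
  class_C k S g -> class_C k S (fun p => / g p).
Proof.
intros Hg.
assert (HI : forall p, S p -> is_derive Rinv (g p) (- / g p * / g p)).
{ intros p Sp; generalize (Hg p Sp); intros.
  auto_derive; [lra|field; lra]. }
induction k as [|k IH]; intros Cg.
- intros p Sp.
  refine (cont_comp S _ (fun q => / (fst q)) g (fun _ => 0) p (fun _ _ => I)
    (taylor_cont _ _ _ _ _ (taylor_of_derive (fun _ => True) Rinv (g p, 0) _
       (HI p Sp))) (Cg p Sp) (taylor_cont _ _ _ _ _ (taylor_const S 0 p))).
- generalize (class_C_pred _ _ _ Cg); intros Cg'; specialize (IH Cg').
  destruct Cg as (gt & gx & H & H1 & H2).
  assert (CI : class_C k S (fun p => - / g p * / g p)).
  { apply class_C_ext with (fun p => (-1) * (/ g p * / g p)); [intros; ring|].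
    apply class_C_mult; [apply class_C_const|apply class_C_mult; auto]. }
  exists (fun p => - / g p * / g p * gt p), (fun p => - / g p * / g p * gx p).
  split; [|split; apply class_C_mult; auto].
  intros p Sp; apply taylor_comp1; auto.
Qed.

(** * The minimum principle on the half-plane *)

(** Extreme value theorem on a rectangle for a function that is continuous
  relative to a larger set. *)
Lemma min_box (S : R * R -> Prop) f T L B : 0 <= T -> 0 <= L ->
  (forall t x, 0 <= t <= T -> - L <= x <= L ->
     S (t, x) /\ cont_on S f (t, x) /\ B <= f (t, x)) ->
  exists t0 x0, 0 <= t0 <= T /\ - L <= x0 <= L /\
    forall t x, 0 <= t <= T -> - L <= x <= L -> f (t0, x0) <= f (t, x).
Proof.
intros HT HL H.
set (E := fun y => exists t x, 0 <= t <= T /\ - L <= x <= L /\ y = - f (t, x)).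
destruct (completeness E) as [m [Hm1 Hm2]].
{ exists (- B); intros y (t & x & Ht & Hx & ->).
  generalize (proj2 (proj2 (H t x Ht Hx))); lra. }
{ exists (- f (0, 0)), 0, 0; repeat split; lra. }
(* if the infimum [- m] is not attained, the values stay locally, hence by
   compactness uniformly, away from it *)
apply NNPP; intros Hno.
assert (Hgap : forall t x, 0 <= t <= T -> - L <= x <= L -> 0 < m + f (t, x)).
{ intros t x Ht Hx; apply Rnot_le_lt; intros Hle; apply Hno.
  exists t, x; repeat split; try lra; intros t' x' Ht' Hx'.
  assert (E (- f (t', x'))) as HE by (exists t', x'; auto).
  generalize (Hm1 _ HE); lra. }
assert (Hex : forall u v, exists d : posreal,
  0 <= u <= T -> - L <= v <= L -> forall t x, 0 <= t <= T -> - L <= x <= L ->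
    Rabs (t - u) < d -> Rabs (x - v) < d -> d <= m + f (t, x)).
{ intros u v.
  destruct (classic (0 <= u <= T /\ - L <= v <= L)) as [[Hu Hv]|Hn].
  - generalize (Hgap u v Hu Hv); intros Hg.
    destruct (proj1 (proj2 (H u v Hu Hv)) ((m + f (u, v)) / 2)) as (d & Hd & Hq);
      [lra|].
    assert (Hpos : 0 < Rmin (d / 2) ((m + f (u, v)) / 2))
      by (apply Rmin_glb_lt; lra).
    exists (mkposreal _ Hpos); intros _ _ t x Ht Hx; simpl.
    generalize (Rmin_l (d / 2) ((m + f (u, v)) / 2))
      (Rmin_r (d / 2) ((m + f (u, v)) / 2)); intros R1 R2 H1 H2.
    specialize (Hq (t, x) (proj1 (H t x Ht Hx))); unfold dist1 in Hq; simpl in Hq.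
    specialize (Hq ltac:(lra)); apply Rabs_def2 in Hq; lra.
  - exists (mkposreal 1 Rlt_0_1); intros Hu Hv; elim Hn; auto. }
set (delta := fun u v => proj1_sig (constructive_indefinite_description _ (Hex u v))).
destruct (compactness_value_2d 0 T (- L) L delta) as [d Hd].
assert (Hub : m <= m - d).
{ apply Hm2; intros y (t & x & Ht & Hx & ->).
  apply Rnot_lt_le; intros Hlt; apply (Hd t x Ht Hx).
  intros (u & v & Hu & Hv & H1 & H2 & H3).
  generalize (proj2_sig (constructive_indefinite_description _ (Hex u v))
    Hu Hv t x Ht Hx H1 H2).
  fold (delta u v); lra. }
generalize (cond_pos d); lra.
Qed.

(** Only the past of [t] matters, so the lemma also applies at the final time. *)
Lemma left_min_derive (f : R -> R) (t l : R) : 0 < t -> is_derive f t l ->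
  (forall s, 0 <= s <= t -> f t <= f s) -> l <= 0.
Proof.
intros Ht H Hm; apply Rnot_lt_le; intros Hl.
destruct (proj1 (is_derive_eps f t l) H (l / 2)) as (d & Hd & Hy); [lra|].
set (h := Rmin (d / 2) t).
assert (Hh : 0 < h) by (apply Rmin_glb_lt; lra).
generalize (Rmin_l (d / 2) t) (Rmin_r (d / 2) t); fold h; intros H1 H2.
specialize (Hy (t - h)); replace (t - h - t) with (- h) in Hy by ring.
rewrite Rabs_Ropp, (Rabs_pos_eq h) in Hy by lra.
specialize (Hy ltac:(lra)); generalize (Hm (t - h) ltac:(lra)); intros.
generalize (Rle_abs (f (t - h) - f t - - h * l)); intros; nra.
Qed.

Lemma interior_min_derive (f : R -> R) (x a b l : R) : a < x < b ->
  is_derive f x l -> (forall y, a <= y <= b -> f x <= f y) -> l = 0.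
Proof.
intros Hx H Hm.
assert (l <= 0).
{ assert (K := left_min_derive (fun s => f (s + a)) (x - a) l ltac:(lra)).
  apply K.
  - apply is_derive_Reals; intros eps He.
    destruct (proj1 (is_derive_Reals f x l) H eps He) as [d Hd]; exists d.
    intros h Hh Hhd; specialize (Hd h Hh Hhd).
    replace (x - a + h + a) with (x + h) by ring.
    replace (x - a + a) with x by ring; exact Hd.
  - intros s Hs; replace (x - a + a) with x by ring; apply Hm; lra. }
assert (- l <= 0).
{ assert (K := left_min_derive (fun s => f (b - s)) (b - x) (- l) ltac:(lra)).
  apply K.
  - replace (- l) with (scal (-1) l) by (unfold scal; simpl; unfold mult; simpl; ring).
    apply (is_derive_comp f (fun s => b - s)).
    + replace (b - (b - x)) with x by ring; exact H.
    + auto_derive; [easy|ring].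
  - intros s Hs; replace (b - (b - x)) with x by ring; apply Hm; lra. }
lra.
Qed.

Lemma interior_min_second_derive (f f' : R -> R) (x a b l : R) : a < x < b ->
  (forall y, a < y < b -> is_derive f y (f' y)) -> is_derive f' x l ->
  (forall y, a <= y <= b -> f x <= f y) -> 0 <= l.
Proof.
intros Hx Hf Hf' Hm; apply Rnot_lt_le; intros Hl.
assert (E : f' x = 0) by (apply (interior_min_derive f x a b); auto).
destruct (proj1 (is_derive_eps f' x l) Hf' (- l / 2)) as (d & Hd & Hy); [lra|].
set (h := Rmin (d / 2) ((b - x) / 2)).
assert (Hh : 0 < h) by (apply Rmin_glb_lt; lra).
generalize (Rmin_l (d / 2) ((b - x) / 2)) (Rmin_r (d / 2) ((b - x) / 2)).
fold h; intros H1 H2.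
assert (Hneg : forall y, x < y <= x + h -> f' y < 0).
{ intros y Hyx; specialize (Hy y); rewrite E, (Rabs_pos_eq (y - x)) in Hy by lra.
  specialize (Hy ltac:(lra)); apply Rabs_le_between in Hy; nra. }
(* [f' < 0] on the right of [x] makes [f] decrease there *)
destruct (MVT_cor2 f f' x (x + h)) as (z & Hz1 & Hz2); [lra| |].
- intros w Hw; apply is_derive_Reals, Hf; lra.
- generalize (Hm (x + h) ltac:(lra)) (Hneg z ltac:(lra)); nra.
Qed.

Lemma half_plane_two_directions : two_directions half_plane.
Proof.
intros t x Ht; unfold half_plane in *; simpl in *.
exists 0, 1; split; [lra|]; intros s Hs; lra.
Qed.

(** Supersolutions of [v_t = a v_xx] that are bounded in space, with at most
  linear growth in time, are nonnegative when their initial values are.  No bound on the derivatives is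
  needed, only the quadratic growth of [a]: the barrier
  [exp (lam * t) * (1 + x ^ 2)] is then a strict supersolution. *)
Lemma minimum_principle (a : R -> R) (A0 : R) (v vt vx w vxx : R * R -> R) :
  (forall x, 0 <= a x <= A0 * (1 + x ^ 2)) ->
  (forall p, half_plane p -> taylor_on half_plane v p (vt p) (vx p)) ->
  (forall p, half_plane p -> taylor_on half_plane vx p (w p) (vxx p)) ->
  (forall p, half_plane p -> a (snd p) * vxx p <= vt p) ->
  (forall x, 0 <= v (0, x)) ->
  (exists B, forall p, half_plane p -> Rabs (v p) <= B + B * fst p) ->
  forall p, half_plane p -> 0 <= v p.
Proof.
intros Ha Hv Hvx Hpde Hinit [B HB] [T q] HT; unfold half_plane in HT; simpl in HT.
assert (HA0 : 0 <= A0) by (generalize (Ha 0); nra).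
assert (HB0 : 0 <= B).
{ generalize (HB (0, 0) (Rle_refl 0)) (Rabs_pos (v (0, 0))); simpl; lra. }
set (lam := 2 * A0 + 1).
set (phi := fun p : R * R => exp (lam * fst p) * (1 + snd p ^ 2)).
assert (Hphi : forall p, 0 <= fst p -> 1 + snd p ^ 2 <= phi p).
{ intros p Hp; unfold phi.
  assert (1 <= exp (lam * fst p)).
  { generalize (exp_ineq1_le (lam * fst p)); unfold lam; nra. }
  nra. }
apply le_epsilon; intros eta Heta.
set (eps := eta / phi (T, q)).
assert (Hphi0 : 0 < phi (T, q)) by (generalize (Hphi (T, q) HT); simpl; nra).
assert (Heps : 0 < eps) by (apply Rdiv_lt_0_compat; lra).
set (u := fun p => v p + eps * phi p).
cut (0 <= u (T, q)).
{ unfold u, eps; intros Hu.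
  replace (eta / phi (T, q) * phi (T, q)) with eta in Hu by (field; lra); lra. }
(* outside of [[-L, L]] the barrier dominates the lower bound of [v] *)
set (L := Rabs q + (B + B * T) / eps + 1).
assert (HBT : 0 <= B + B * T) by nra.
assert (HBe : 0 <= (B + B * T) / eps)
  by (apply Rmult_le_pos; [lra|apply Rlt_le, Rinv_0_lt_compat; lra]).
assert (HL : 1 <= L) by (unfold L; generalize (Rabs_pos q); lra).
assert (HLe : B + B * T <= eps * L).
{ unfold L; replace (B + B * T) with (eps * ((B + B * T) / eps)) at 1 by (field; lra).
  apply Rmult_le_compat_l; [lra|]; generalize (Rabs_pos q); lra. }
assert (Hlow : forall t x, 0 <= t <= T -> - (B + B * T) <= v (t, x)).
{ intros t x Ht; generalize (HB (t, x) (proj1 Ht)); simpl; intros K.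
  apply Rabs_le_between in K; nra. }
assert (Hphicont : forall p, cont_on half_plane phi p).
{ intros p.
  assert (H1 : taylor_on half_plane (fun p => exp (lam * fst p)) p
     (lam * exp (lam * fst p)) 0).
  { apply (taylor_of_derive half_plane (fun s => exp (lam * s))).
    auto_derive; [easy|ring]. }
  assert (H2 : taylor_on half_plane (fun p => 1 + snd p ^ 2) p
     (2 * snd p * 0) (2 * snd p * 1)).
  { apply (taylor_comp1 half_plane (fun x => 1 + x ^ 2) snd); [|apply taylor_snd].
    auto_derive; [easy|ring]. }
  exact (taylor_cont _ _ _ _ _ (taylor_mult _ _ _ _ _ _ _ _ H1 H2)). }
assert (Hucont : forall p, half_plane p -> cont_on half_plane u p).
{ intros p Hp.
  apply (class_C_plus 0 half_plane v (fun q => eps * phi q)); [| |exact Hp].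
  - intros p' Hp'; exact (taylor_cont _ _ _ _ _ (Hv p' Hp')).
  - apply (class_C_mult 0 half_plane (fun _ => eps) phi).
    + apply (class_C_const 0).
    + intros p' _; apply Hphicont. }
destruct (min_box half_plane u T L (- (B + B * T)) HT ltac:(lra))
  as (t0 & x0 & Ht0 & Hx0 & Hmin).
{ intros t x Ht Hx; split; [exact (proj1 Ht)|]; split; [apply Hucont, Ht|].
  unfold u; generalize (Hlow t x Ht) (Hphi (t, x) (proj1 Ht)); simpl; intros; nra. }
assert (Hq : - L <= q <= L).
{ unfold L; generalize (Rle_abs q) (Rle_abs (- q)); rewrite Rabs_Ropp; lra. }
apply Rle_trans with (u (t0, x0)); [|apply Hmin; lra].
apply Rnot_lt_le; intros Hneg.
assert (Ht0' : 0 < t0).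
{ destruct (Rle_lt_or_eq_dec 0 t0) as [Hlt|E]; [lra|exact Hlt|].
  exfalso; subst t0; generalize (Hinit x0) (Hphi (0, x0) (Rle_refl 0)).
  unfold u in Hneg; simpl; intros; nra. }
assert (Hside : x0 <> L /\ x0 <> - L).
{ generalize (Hlow t0 x0 Ht0) (Hphi (t0, x0) (proj1 Ht0)); unfold u in Hneg; simpl.
  intros; split; intros ->; nra. }
assert (Hp0 : half_plane (t0, x0)) by exact (proj1 Ht0).
assert (Dt : is_derive (fun s => u (s, x0)) t0
  (vt (t0, x0) + eps * (lam * phi (t0, x0)))).
{ apply (is_derive_plus (fun s => v (s, x0)) (fun s => eps * phi (s, x0))).
  - apply derive_slice_t with half_plane (vx (t0, x0)); [|apply Hv; exact Hp0].
    exists t0; split; [lra|]; intros s Hs; unfold half_plane; simpl.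
    apply Rabs_def2 in Hs; lra.
  - unfold phi; simpl; auto_derive; [easy|ring]. }
assert (Dx : forall y, is_derive (fun y => u (t0, y)) y
  (vx (t0, y) + eps * (exp (lam * t0) * (2 * y)))).
{ intros y; apply (is_derive_plus (fun y => v (t0, y)) (fun y => eps * phi (t0, y))).
  - apply derive_slice_x with half_plane (vt (t0, y));
      [intros z; exact (proj1 Ht0)|apply Hv; exact (proj1 Ht0)].
  - unfold phi; simpl; auto_derive; [easy|ring]. }
assert (Dxx : is_derive (fun y => vx (t0, y) + eps * (exp (lam * t0) * (2 * y))) x0
  (vxx (t0, x0) + eps * (exp (lam * t0) * 2))).
{ apply (is_derive_plus (fun y => vx (t0, y))
    (fun y => eps * (exp (lam * t0) * (2 * y)))).
  - apply derive_slice_x with half_plane (w (t0, x0));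
      [intros z; exact (proj1 Ht0)|apply Hvx; exact (proj1 Ht0)].
  - auto_derive; [easy|ring]. }
assert (Kt : vt (t0, x0) + eps * (lam * phi (t0, x0)) <= 0).
{ apply (left_min_derive _ _ _ Ht0' Dt); intros s Hs; apply Hmin; lra. }
assert (Kx : 0 <= vxx (t0, x0) + eps * (exp (lam * t0) * 2)).
{ apply (interior_min_second_derive (fun y => u (t0, y)) _ x0 (- L) L _)
    with (3 := Dxx); [lra|intros; apply Dx|].
  intros y Hy; apply Hmin; lra. }
generalize (Hpde (t0, x0) Hp0); simpl; intros Kp.
destruct (Ha x0) as [Ha0 Ha1].
assert (He : 0 < eps * exp (lam * t0)) by (apply Rmult_lt_0_compat; [lra|apply exp_pos]).
unfold phi in Kt; simpl fst in Kt; simpl snd in Kt.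
set (e := eps * exp (lam * t0)) in *.
replace (eps * (lam * (exp (lam * t0) * (1 + x0 ^ 2))))
  with (e * ((2 * A0 + 1) * (1 + x0 ^ 2))) in Kt by (unfold e, lam; ring).
replace (eps * (exp (lam * t0) * 2)) with (e * 2) in Kx by (unfold e; ring).
assert (a x0 * (vxx (t0, x0) + e * 2) >= 0) by (apply Rle_ge, Rmult_le_pos; lra).
assert (a x0 * e <= A0 * (1 + x0 ^ 2) * e) by (apply Rmult_le_compat_r; lra).
assert (0 < e * (1 + x0 ^ 2)) by (apply Rmult_lt_0_compat; nra).
lra.
Qed.

(** * A priori bounds for bounded solutions *)

Lemma taylor_eq S f p a b a' b' : taylor_on S f p a b -> a = a' -> b = b' ->
  taylor_on S f p a' b'.
Proof. intros H <- <-; exact H. Qed.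

Lemma taylor_scal S f k p a b : taylor_on S f p a b ->
  taylor_on S (fun q => k * f q) p (k * a) (k * b).
Proof.
intros H; eapply taylor_eq.
- apply (taylor_mult S (fun _ => k) f p); [apply taylor_const|exact H].
- ring.
- ring.
Qed.

Lemma taylor_init f p a b : taylor_on half_plane f (0, snd p) a b ->
  taylor_on half_plane (fun q => f (0, snd q)) p 0 b.
Proof.
intros H; eapply taylor_eq.
- apply (taylor_comp half_plane half_plane f (fun _ => 0) snd p).
  + intros q _; apply Rle_refl.
  + exact H.
  + apply taylor_const.
  + apply taylor_snd.
- ring.
- ring.
Qed.

Lemma taylor_shift f h p a b : 0 <= h -> taylor_on half_plane f (fst p + h, snd p) a b ->
  taylor_on half_plane (fun q => f (fst q + h, snd q)) p a b.
Proof.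
intros Hh H; eapply taylor_eq.
- apply (taylor_comp half_plane half_plane f (fun q => fst q + h) snd p).
  + intros q Hq; unfold half_plane in *; simpl; lra.
  + exact H.
  + apply taylor_plus; [apply taylor_fst|apply taylor_const].
  + apply taylor_snd.
- ring.
- ring.
Qed.

Section Bounds.

Variables (a : R -> R) (A0 A B : R) (c ct cx cxt cxx : R * R -> R).
Hypothesis Ha : forall x, 0 <= a x <= A0 * (1 + x ^ 2).
Hypothesis Hc : forall p, half_plane p -> taylor_on half_plane c p (ct p) (cx p).
Hypothesis Hcx : forall p, half_plane p -> taylor_on half_plane cx p (cxt p) (cxx p).
Hypothesis Hpde : forall p, half_plane p -> ct p = a (snd p) * cxx p.
Hypothesis HB : forall p, half_plane p -> Rabs (c p) <= B.
Hypothesis HA : forall x, Rabs (a x * cxx (0, x)) <= A.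

Let hp0 x : half_plane (0, x) := Rle_refl 0.

Lemma A_nonneg : 0 <= A.
Proof. generalize (HA 0) (Rabs_pos (a 0 * cxx (0, 0))); lra. Qed.

Lemma B_nonneg : 0 <= B.
Proof. generalize (HB (0, 0) (hp0 0)) (Rabs_pos (c (0, 0))); lra. Qed.

(** [c(0, x) - A t <= c(t, x) <= c(0, x) + A t], since both sides are barriers;
  the signs [s = 1] and [s = -1] give the two inequalities. *)
Lemma initial_time_Lipschitz (s : R) p : Rabs s = 1 -> half_plane p ->
  0 <= A * fst p + s * (c (0, snd p) + (-1) * c p).
Proof.
intros Hs.
apply (minimum_principle a A0
  (fun p => A * fst p + s * (c (0, snd p) + (-1) * c p))
  (fun p => A + s * ((-1) * ct p))
  (fun p => s * (cx (0, snd p) + (-1) * cx p))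
  (fun p => s * ((-1) * cxt p))
  (fun p => s * (cxx (0, snd p) + (-1) * cxx p)) Ha).
- intros q Hq; eapply taylor_eq.
  + apply taylor_plus; [apply taylor_scal, taylor_fst|].
    apply taylor_scal, taylor_plus; [|apply taylor_scal, Hc, Hq].
    apply taylor_init with (ct (0, snd q)), Hc, hp0.
  + ring.
  + ring.
- intros q Hq; eapply taylor_eq.
  + apply taylor_scal, taylor_plus; [|apply taylor_scal, Hcx, Hq].
    apply taylor_init with (cxt (0, snd q)), Hcx, hp0.
  + ring.
  + ring.
- intros q Hq; rewrite Hpde by exact Hq.
  assert (s * (a (snd q) * cxx (0, snd q)) <= A).
  { apply Rle_trans with (1 := Rle_abs _); rewrite Rabs_mult, Hs, Rmult_1_l.
    apply HA. }
  lra.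
- intros x; simpl; lra.
- exists (A + 2 * B); intros q Hq.
  apply Rle_trans with (1 := Rabs_triang _ _); rewrite !Rabs_mult, Hs.
  generalize (Rabs_triang (c (0, snd q)) (-1 * c q)); rewrite Rabs_mult.
  rewrite (Rabs_Ropp 1 : Rabs (-1) = _), Rabs_R1.
  generalize (HB _ (hp0 (snd q))) (HB _ Hq) A_nonneg B_nonneg; intros.
  unfold half_plane in Hq; rewrite !Rabs_pos_eq with (x := fst q) by exact Hq.
  rewrite Rabs_pos_eq by assumption; nra.
Qed.

(** [c(t + h, x) - c(t, x)] solves the equation, and its initial values are at most
  [A h] in absolute value by the previous lemma. *)
Lemma time_Lipschitz (s h : R) p : Rabs s = 1 -> 0 <= h -> half_plane p ->
  0 <= A * h + s * (c (fst p + h, snd p) + (-1) * c p).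
Proof.
intros Hs Hh.
assert (hph : forall q, half_plane q -> half_plane (fst q + h, snd q))
  by (intros q; unfold half_plane; simpl; lra).
apply (minimum_principle a A0
  (fun p => A * h + s * (c (fst p + h, snd p) + (-1) * c p))
  (fun p => s * (ct (fst p + h, snd p) + (-1) * ct p))
  (fun p => s * (cx (fst p + h, snd p) + (-1) * cx p))
  (fun p => s * (cxt (fst p + h, snd p) + (-1) * cxt p))
  (fun p => s * (cxx (fst p + h, snd p) + (-1) * cxx p)) Ha).
- intros q Hq; eapply taylor_eq.
  + apply taylor_plus; [apply taylor_const|].
    apply taylor_scal, taylor_plus; [|apply taylor_scal, Hc, Hq].
    apply taylor_shift; [exact Hh|]; apply Hc, hph, Hq.
  + ring.
  + ring.
- intros q Hq; apply taylor_scal, taylor_plus; [|apply taylor_scal, Hcx, Hq].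
  apply taylor_shift; [exact Hh|]; apply Hcx, hph, Hq.
- intros q Hq; rewrite (Hpde q Hq), (Hpde _ (hph q Hq)); simpl; lra.
- intros x; simpl; rewrite Rplus_0_l.
  generalize (initial_time_Lipschitz (- s) (h, x)); rewrite Rabs_Ropp.
  intros K; specialize (K Hs Hh); simpl in K; lra.
- exists (A * h + 2 * B); intros q Hq.
  assert (0 <= A * h) by (apply Rmult_le_pos; [apply A_nonneg|exact Hh]).
  apply Rle_trans with (1 := Rabs_triang _ _).
  rewrite (Rabs_pos_eq (A * h)) by assumption; rewrite !Rabs_mult, Hs.
  generalize (Rabs_triang (c (fst q + h, snd q)) (-1 * c q)); rewrite Rabs_mult.
  rewrite (Rabs_Ropp 1 : Rabs (-1) = _), Rabs_R1.
  generalize (HB _ (hph _ Hq)) (HB _ Hq) B_nonneg; intros.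
  unfold half_plane in Hq; nra.
Qed.

Lemma time_derivative_bound p : half_plane p -> Rabs (ct p) <= A.
Proof.
destruct p as [t x]; intros Hp; apply le_epsilon; intros eps He.
destruct (taylor_direction half_plane c t x (ct (t, x)) (cx (t, x)) 1 0 1 Rlt_0_1)
  with (eps := eps) as (e & Hpos & H).
- unfold half_plane in *; simpl in *; intros; lra.
- apply Hc, Hp.
- exact He.
- specialize (H e ltac:(lra)); rewrite !Rmult_1_l, !Rmult_0_l, !Rplus_0_r in H.
  set (r := (c (t + e, x) - c (t, x)) / e) in *.
  assert (Hr : Rabs r <= A).
  { generalize (time_Lipschitz 1 e (t, x) Rabs_R1 ltac:(lra) Hp).
    generalize (time_Lipschitz (-1) e (t, x)
      (eq_trans (Rabs_Ropp 1) Rabs_R1) ltac:(lra) Hp).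
    simpl; intros K1 K2; unfold r; apply Rabs_le_between; split.
    - apply Rle_div_r; lra.
    - apply Rle_div_l; lra. }
  rewrite Rabs_minus_sym in H.
  generalize (Rabs_triang (ct (t, x) - r) r).
  replace (ct (t, x) - r + r) with (ct (t, x)) by ring; lra.
Qed.

(** Landau's inequality on [[x, x + 1]]. *)
Lemma space_derivative_bound t x N : 0 <= t ->
  (forall y, x <= y -> Rabs (cxx (t, y)) <= N) ->
  Rabs (cx (t, x)) <= 2 * B + N.
Proof.
intros Ht HN.
assert (hpt : forall y, half_plane (t, y)) by (intros; exact Ht).
destruct (MVT_cor2 (fun y => c (t, y)) (fun y => cx (t, y)) x (x + 1))
  as (y & Hy & Hxy); [lra| |].
{ intros z _; apply is_derive_Reals.
  apply derive_slice_x with half_plane (ct (t, z)); [exact hpt|apply Hc, hpt]. }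
destruct (MVT_cor2 (fun y => cx (t, y)) (fun y => cxx (t, y)) x y)
  as (z & Hz & Hxz); [lra| |].
{ intros z _; apply is_derive_Reals.
  apply derive_slice_x with half_plane (cxt (t, z)); [exact hpt|apply Hcx, hpt]. }
generalize (HB _ (hpt x)) (HB _ (hpt (x + 1))) (HN z ltac:(lra)).
intros K1 K2 K3; apply Rabs_le_between in K1, K2, K3; apply Rabs_le_between.
replace (x + 1 - x) with 1 in Hy by ring; nra.
Qed.

End Bounds.

(** * The backward characteristics [Q] *)

Section Characteristics.

Variables (Fn : nat -> R -> R) (M : R).
Let F := Fn 0%nat.
Hypothesis HF : derivatives_pos Fn.
Hypothesis HM : 0 < M.
Hypothesis Fpos : forall x, M <= x -> 0 < F x.
Hypothesis Fincr : forall x y, M <= x -> x <= y -> F x <= F y.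

Let G := Gfun F M.
Let Z := Zdom F M.
Let Q := Qfun F M.

Lemma F_cont x eps : 0 < x -> 0 < eps ->
  exists d, 0 < d /\ forall y, Rabs (y - x) < d -> Rabs (F y - F x) < eps.
Proof.
intros Hx He.
assert (K : continuity_pt F x).
{ apply derivable_continuous_pt; exists (Fn 1%nat x).
  apply is_derive_Reals, (HF 0%nat), Hx. }
destruct (K eps He) as (d & Hd & H); exists d; split; [exact Hd|].
intros y Hy; destruct (Req_dec y x) as [->|N].
- rewrite Rminus_diag, Rabs_R0; exact He.
- apply H; split; [split; [exact I|auto]|exact Hy].
Qed.

Lemma inv_F_continuous z : 0 < z -> 0 < F z -> continuous (fun y => / F y) z.
Proof.
intros Hz Hp; apply (ex_derive_continuous (fun y => / F y)).
eexists; apply is_derive_inv; [apply (HF 0%nat); exact Hz|apply Rgt_not_eq, Hp].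
Qed.

Lemma G_derive x : M <= x -> is_derive G x (/ F x).
Proof.
intros Hx.
(* [F] is still positive slightly to the left of [M], which makes [G]
   differentiable at [M] from both sides *)
destruct (F_cont M (F M) HM (Fpos M (Rle_refl M))) as (d & Hd & Hcont).
set (e := Rmin d M).
assert (He : 0 < e) by (apply Rmin_glb_lt; assumption).
assert (Hpos : forall z, M - e < z -> 0 < z /\ 0 < F z).
{ intros z Hz; generalize (Rmin_l d M) (Rmin_r d M); fold e; intros.
  split; [lra|]; destruct (Rle_dec M z) as [Hz'|Hz']; [apply Fpos, Hz'|].
  specialize (Hcont z); rewrite (Rabs_left (z - M)) in Hcont by lra.
  specialize (Hcont ltac:(lra)); apply Rabs_def2 in Hcont; lra. }
apply (is_derive_RInt (fun y => / F y) G M x).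
- exists (mkposreal e He); intros b Hb.
  assert (Hb' : M - e < b).
  { unfold ball in Hb; simpl in Hb; unfold AbsRing_ball, abs, minus, plus, opp in Hb.
    simpl in Hb; apply Rabs_def2 in Hb; lra. }
  apply (@RInt_correct R_CompleteNormedModule), ex_RInt_continuous; intros z Hz.
  assert (M - e < z).
  { apply Rlt_le_trans with (Rmin M b); [apply Rmin_glb_lt; lra|apply Hz]. }
  apply inv_F_continuous; apply Hpos; assumption.
- apply inv_F_continuous; [lra|apply Fpos, Hx].
Qed.

Lemma G_M : G M = 0.
Proof. apply (RInt_point (V := R_CompleteNormedModule)). Qed.

(** Mean value theorem for [G], solved for the increment of the argument. *)
Lemma G_mvt y1 y2 : M <= y1 -> M <= y2 -> exists z,
  M <= z /\ Rmin y1 y2 <= z <= Rmax y1 y2 /\ y2 - y1 = F z * (G y2 - G y1).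
Proof.
intros H1 H2.
assert (HM' : M <= Rmin y1 y2) by (apply Rmin_glb; assumption).
destruct (MVT_gen G y1 y2 (fun y => / F y)) as (z & Hz & E).
- intros z Hz; apply G_derive; lra.
- intros z Hz; apply derivable_continuous_pt; exists (/ F z).
  apply is_derive_Reals, G_derive; lra.
- exists z; split; [lra|]; split; [exact Hz|].
  rewrite E; field; apply Rgt_not_eq, Fpos; lra.
Qed.

Lemma G_incr x y : M <= x -> x < y -> G x < G y.
Proof.
intros Hx Hxy; destruct (G_mvt x y) as (z & Hz & _ & E); [lra|lra|].
generalize (Fpos z Hz); intros; nra.
Qed.

Lemma G_incr_le x y : M <= x -> x <= y -> G x <= G y.
Proof. intros Hx [H| ->]; [left; apply G_incr; assumption|right; reflexivity]. Qed.

(** For [s] between [0] and [G x], a preimage is found in [[M, x]], so that the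
  divergence of [G] at infinity plays no role. *)
Lemma Ginv_spec s x : M <= x -> 0 <= s <= G x ->
  M <= Ginv F M s <= x /\ G (Ginv F M s) = s.
Proof.
intros Hx Hs.
assert (Hex : exists y, M <= y <= x /\ G y = s).
{ destruct (Req_dec s 0) as [->|N0]; [exists M; split; [lra|apply G_M]|].
  destruct (Req_dec s (G x)) as [->|N1]; [exists x; split; [lra|reflexivity]|].
  destruct (Ranalysis5.IVT_interv (fun y => G y - s) M x) as (y & Hy & E).
  - intros y Hy; apply derivable_continuous_pt; exists (/ F y - 0).
    apply is_derive_Reals.
    apply (is_derive_minus (V := R_NormedModule) G (fun _ => s)).
    + apply G_derive; lra.
    + apply (is_derive_const (V := R_NormedModule)).
  - destruct Hx as [Hx| <-]; [exact Hx|]; rewrite G_M in Hs; lra.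
  - rewrite G_M; lra.
  - lra.
  - exists y; split; [exact Hy|lra]. }
destruct Hex as (y & Hy & E).
replace (Ginv F M s) with y; [split; assumption|symmetry].
apply (@iota_unique R_AbsRing R_CompleteNormedModule); [|split; [lra|exact E]].
intros z [Hz Ez]; fold G in Ez.
destruct (Rtotal_order z y) as [H|[H|H]]; [exfalso|exact H|exfalso].
- generalize (G_incr z y Hz H); lra.
- generalize (G_incr y z (proj1 Hy) H); lra.
Qed.

Lemma Q_spec p : Z p -> M <= Q p <= snd p /\ G (Q p) = G (snd p) - fst p.
Proof.
intros (H1 & H2 & H3); apply Ginv_spec; [exact H2|].
fold F G in H3; fold G; lra.
Qed.

Lemma Z_two_directions : two_directions Z.
Proof.
intros t x (H1 & H2 & H3); simpl in *; fold G in H3.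
assert (HF1 : 0 < F (x + 1)) by (apply Fpos; lra).
exists (F (x + 1)), (/ F (x + 1)); split; [apply Rinv_0_lt_compat, HF1|].
intros s Hs.
assert (Hks : 0 <= F (x + 1) * s <= 1).
{ split; [nra|]; apply Rle_trans with (F (x + 1) * / F (x + 1)).
  - apply Rmult_le_compat_l; lra.
  - right; field; lra. }
split; (split; [|split]); simpl; fold G; try lra.
- apply Rle_trans with (1 := H3), G_incr_le; lra.
- (* [G] grows at least at rate [1 / F (x + 1)] on [[x, x + 1]] *)
  destruct (G_mvt x (x + F (x + 1) * s)) as (z & Hz & Hz' & E); [lra|lra|].
  rewrite Rmax_right in Hz' by lra.
  assert (F z <= F (x + 1)) by (apply Fincr; lra).
  assert (Hd : 0 <= G (x + F (x + 1) * s) - G x)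
    by (generalize (G_incr_le x (x + F (x + 1) * s)); lra).
  assert (F (x + 1) * s <= F (x + 1) * (G (x + F (x + 1) * s) - G x)) by nra.
  assert (s <= G (x + F (x + 1) * s) - G x)
    by (apply Rmult_le_reg_l with (F (x + 1)); assumption).
  lra.
Qed.

Lemma time_taylor p : M <= snd p ->
  taylor_on Z (fun q => G (snd q) + (-1) * fst q) p (-1) (/ F (snd p)).
Proof.
intros Hp; eapply taylor_eq.
- apply taylor_plus.
  + apply (taylor_comp1 Z G snd); [apply G_derive, Hp|apply taylor_snd].
  + apply taylor_scal, taylor_fst.
- ring.
- ring.
Qed.

(** [Q q - Q p = F z * (H q - H p)] for some [z] between [Q p] and [Q q], where
  [H (t, x) = G x - t].  Since [F] is bounded near [p], this first gives the
  continuity of [Q], then its expansion as [F z] tends to [F (Q p)]. *)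
Lemma Q_taylor p : Z p -> taylor_on Z Q p (- F (Q p)) (F (Q p) * / F (snd p)).
Proof.
intros Zp; set (H := fun q : R * R => G (snd q) + (-1) * fst q).
destruct (Q_spec p Zp) as [HQp EQp].
assert (HM' : M <= snd p) by lra.
generalize (time_taylor p HM'); fold H; intros TH.
destruct (taylor_Lipschitz _ _ _ _ _ TH) as (l & d0 & Hl & Hd0 & HLip).
set (N := F (snd p + 1)).
assert (HN : 0 < N) by (apply Fpos; lra).
assert (Hmvt : forall q, Z q -> dist1 p q < 1 -> exists z,
  0 < F z <= N /\ Rabs (z - Q p) <= Rabs (Q q - Q p)
  /\ Q q - Q p = F z * (H q - H p)).
{ intros q Zq Hpq; destruct (Q_spec q Zq) as [HQq EQq].
  destruct (G_mvt (Q p) (Q q)) as (z & Hz & Hz' & E); [lra|lra|].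
  exists z; split; [split|split].
  - apply Fpos, Hz.
  - apply Fincr; [exact Hz|]; apply Rle_trans with (1 := proj2 Hz').
    unfold dist1 in Hpq; generalize (Rabs_pos (fst q - fst p)); intros.
    assert (Hs : Rabs (snd q - snd p) < 1) by lra; apply Rabs_def2 in Hs.
    apply Rmax_lub; lra.
  - unfold Rmin, Rmax in Hz'; destruct (Rle_dec (Q p) (Q q)).
    + rewrite !Rabs_pos_eq; lra.
    + rewrite !Rabs_left1; lra.
  - rewrite E, EQp, EQq; unfold H; ring. }
intros eps He.
destruct (TH (eps / 2 / N)) as (d1 & Hd1 & H1); [repeat apply Rdiv_lt_0_compat; lra|].
destruct (F_cont (Q p) (eps / 2 / l)) as (d2 & Hd2 & H2);
  [lra|repeat apply Rdiv_lt_0_compat; lra|].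
set (d3 := d2 / (N * l)).
assert (HNl : 0 < N * l) by (apply Rmult_lt_0_compat; assumption).
assert (Hd3 : 0 < d3) by (apply Rdiv_lt_0_compat; assumption).
exists (Rmin (Rmin 1 d0) (Rmin d1 d3)); split;
  [repeat apply Rmin_glb_lt; lra|].
intros q Zq Hpq.
generalize (Rmin_l (Rmin 1 d0) (Rmin d1 d3)) (Rmin_r (Rmin 1 d0) (Rmin d1 d3))
  (Rmin_l 1 d0) (Rmin_r 1 d0) (Rmin_l d1 d3) (Rmin_r d1 d3); intros.
destruct (Hmvt q Zq ltac:(lra)) as (z & Hz & Hzd & E).
specialize (HLip q Zq ltac:(lra)); specialize (H1 q Zq ltac:(lra)).
assert (Hclose : Rabs (z - Q p) < d2).
{ apply Rle_lt_trans with (1 := Hzd); rewrite E, Rabs_mult, (Rabs_pos_eq (F z)) by lra.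
  apply Rle_lt_trans with (N * (l * dist1 p q)).
  - apply Rmult_le_compat; [lra|apply Rabs_pos|lra|exact HLip].
  - rewrite <- Rmult_assoc; apply Rlt_le_trans with (N * l * d3).
    + apply Rmult_lt_compat_l; lra.
    + unfold d3; right; field; lra. }
specialize (H2 z Hclose).
set (lin := (fst q - fst p) * -1 + (snd q - snd p) * / F (snd p)) in *.
replace (Q q - Q p - ((fst q - fst p) * - F (Q p)
    + (snd q - snd p) * (F (Q p) * / F (snd p))))
  with (F (Q p) * (H q - H p - lin) + (F z - F (Q p)) * (H q - H p))
  by (rewrite E; unfold lin; ring).
assert (HFQ : 0 < F (Q p) <= N) by (split; [apply Fpos|apply Fincr]; lra).
apply Rle_trans with (1 := Rabs_triang _ _); rewrite !Rabs_mult.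
rewrite (Rabs_pos_eq (F (Q p))) by lra.
apply Rle_trans with (N * (eps / 2 / N * dist1 p q) + eps / 2 / l * (l * dist1 p q)).
- apply Rplus_le_compat; apply Rmult_le_compat; try apply Rabs_pos; lra.
- right; field; lra.
Qed.

Lemma Z_pos p : Z p -> 0 < snd p.
Proof. intros (_ & H & _); lra. Qed.

Lemma Q_pos p : Z p -> 0 < Q p.
Proof. intros Zp; generalize (Q_spec p Zp); lra. Qed.

Lemma class_C_F k : class_C k Z (fun p => F (snd p)).
Proof.
exact (class_C_comp1 k Z Fn snd HF Z_pos (class_C_snd k Z) 0%nat).
Qed.

Lemma class_C_inv_F k : class_C k Z (fun p => / F (snd p)).
Proof.
apply class_C_inv; [|apply class_C_F]; intros p (_ & H & _); apply Fpos, H.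
Qed.

(** Bootstrap: both partial derivatives of [Q] are smooth functions of [Q] and [x]. *)
Lemma class_C_Q k : class_C k Z Q.
Proof.
induction k as [|k IH].
- intros p Zp; exact (taylor_cont _ _ _ _ _ (Q_taylor p Zp)).
- assert (CF : class_C k Z (fun p => F (Q p)))
    by exact (class_C_comp1 k Z Fn Q HF Q_pos IH 0%nat).
  exists (fun p => - F (Q p)), (fun p => F (Q p) * / F (snd p)).
  split; [exact Q_taylor|split].
  + apply class_C_ext with (fun p => (-1) * F (Q p)); [intros; ring|].
    apply class_C_mult; [apply class_C_const|exact CF].
  + apply class_C_mult; [exact CF|apply class_C_inv_F].
Qed.

Lemma Q_distance p : Z p -> snd p - Q p <= fst p * F (snd p).
Proof.
intros Zp; destruct (Q_spec p Zp) as [HQ E].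
destruct (G_mvt (Q p) (snd p)) as (z & Hz & Hz' & E'); [lra|lra|].
rewrite E' , E; replace (G (snd p) - (G (snd p) - fst p)) with (fst p) by ring.
rewrite Rmax_right in Hz' by lra.
rewrite (Rmult_comm (F z)); apply Rmult_le_compat_l; [exact (proj1 Zp)|].
apply Fincr; lra.
Qed.

(** If [F y <= L * y], then [ln] increases at most at rate [L] along the
  characteristics: [ln - L * G] is non-increasing. *)
Lemma Q_comparable L p : (forall y, M <= y -> F y <= L * y) -> Z p ->
  snd p <= Q p * exp (L * fst p).
Proof.
intros HL Zp; destruct (Q_spec p Zp) as [HQ E].
assert (K : ln (snd p) - L * G (snd p) <= ln (Q p) - L * G (Q p)).
{ destruct (MVT_gen (fun y => ln y - L * G y) (Q p) (snd p)
    (fun y => / y - L * / F y)) as (z & Hz & E').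
  - rewrite Rmin_left, Rmax_right by lra; intros y Hy.
    apply (is_derive_minus (V := R_NormedModule) ln (fun y => L * G y)).
    + apply is_derive_ln; lra.
    + apply is_derive_scal, G_derive; lra.
  - rewrite Rmin_left, Rmax_right by lra; intros y Hy.
    apply derivable_continuous_pt; exists (/ y - L * / F y); apply is_derive_Reals.
    apply (is_derive_minus (V := R_NormedModule) ln (fun y => L * G y)).
    + apply is_derive_ln; lra.
    + apply is_derive_scal, G_derive; lra.
  - rewrite Rmin_left, Rmax_right in Hz by lra.
    assert (Hz0 : 0 < F z) by (apply Fpos; lra).
    assert (/ z - L * / F z <= 0).
    { replace (/ z - L * / F z) with ((F z - L * z) / (z * F z)) by (field; lra).
      apply Rle_div_l; [apply Rmult_lt_0_compat; lra|].
      generalize (HL z ltac:(lra)); lra. }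
    nra. }
rewrite E in K.
apply Rle_trans with (exp (ln (Q p) + L * fst p)).
- rewrite <- (exp_ln (snd p)) at 1 by lra.
  destruct (Rle_lt_or_eq_dec (ln (snd p)) (ln (Q p) + L * fst p)) as [H|H]; [lra| |].
  + left; apply exp_increasing, H.
  + right; f_equal; exact H.
- rewrite exp_plus, exp_ln by lra; lra.
Qed.

End Characteristics.

(** * The remainder *)

Section Remainder.

Variables (Fn Dn : nat -> R -> R) (M : R).
Let F := Fn 0%nat.
Let D := Dn 0%nat.
Hypothesis HF : derivatives_pos Fn.
Hypothesis HD : derivatives_pos Dn.
Hypothesis HM : 0 < M.
Hypothesis Fpos : forall x, M <= x -> 0 < F x.
Hypothesis Fincr : forall x y, M <= x -> x <= y -> F x <= F y.

Variables c ct cx cxt cxx : R * R -> R.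
Hypothesis Hc : forall p, half_plane p -> taylor_on half_plane c p (ct p) (cx p).
Hypothesis Hcx : forall p, half_plane p -> taylor_on half_plane cx p (cxt p) (cxx p).

Let Z := Zdom F M.
Let Q := Qfun F M.
Let C := fun p : R * R => c (fst p, Q p).

(** [r = Q_x], the derivative of the characteristic in its end point. *)
Let r := fun p : R * R => F (Q p) * / F (snd p).

(** The derivative of [r] in [x]. *)
Let r_x := fun p : R * R =>
  Fn 1%nat (Q p) * r p * / F (snd p)
  - F (Q p) * Fn 1%nat (snd p) * / F (snd p) * / F (snd p).

Let Z2 : two_directions Z := Z_two_directions Fn M HF HM Fpos Fincr.

Let Qs p (Zp : Z p) : M <= Q p <= snd p /\ _ := Q_spec Fn M HF HM Fpos p Zp.

Let Qt p (Zp : Z p) : taylor_on Z Q p (- F (Q p)) (r p) :=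
  Q_taylor Fn M HF HM Fpos Fincr p Zp.

(** Differential of [f(t, Q(t, x))]: the derivative along the characteristics. *)
Lemma along_taylor f p a b : Z p -> taylor_on half_plane f (fst p, Q p) a b ->
  taylor_on Z (fun q => f (fst q, Q q)) p (a - b * F (Q p)) (b * r p).
Proof.
intros Zp H; eapply taylor_eq.
- apply (taylor_comp Z half_plane f fst Q p).
  + intros q Zq; exact (proj1 Zq).
  + exact H.
  + apply taylor_fst.
  + exact (Qt p Zp).
- ring.
- ring.
Qed.

Lemma of_x_taylor (f : R -> R) (p : R * R) (l : R) : is_derive f (snd p) l ->
  taylor_on Z (fun q => f (snd q)) p 0 l.
Proof.
intros H; eapply taylor_eq.
- apply (taylor_comp1 Z f snd p l 0 1 H), taylor_snd.
- ring.
- ring.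
Qed.

Lemma r_taylor p : Z p -> exists a, taylor_on Z r p a (r_x p).
Proof.
intros Zp; assert (HQ := Qs p Zp).
assert (Hx : 0 < snd p) by lra.
assert (HFx : 0 < F (snd p)) by (apply Fpos; lra).
eexists; eapply taylor_eq.
- apply taylor_mult.
  + apply (taylor_comp1 Z F Q p (Fn 1%nat (Q p))).
    * apply (HF 0%nat); lra.
    * exact (Qt p Zp).
  + apply (of_x_taylor (fun y => / F y) p).
    apply is_derive_inv; [apply (HF 0%nat); exact Hx|apply Rgt_not_eq, HFx].
- reflexivity.
- unfold r_x; fold F; field; lra.
Qed.

Lemma C_taylor p : Z p ->
  taylor_on Z C p (ct (fst p, Q p) - cx (fst p, Q p) * F (Q p))
    (cx (fst p, Q p) * r p).
Proof. intros Zp; apply (along_taylor c p); [exact Zp|apply Hc, (proj1 Zp)]. Qed.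

Lemma class_C_C k : class_C k half_plane c -> class_C k Z C.
Proof.
intros H; apply (class_C_comp k Z half_plane fst Q); [|apply class_C_fst| |exact H].
- intros q Zq; exact (proj1 Zq).
- exact (class_C_Q Fn M HF HM Fpos Fincr k).
Qed.

(** The defect of [C] in the equation [C_t = - (F C)_x + (D C)_xx / 2]. *)
Definition remainder (p : R * R) : R :=
  partial_t Z C p + partial_x Z (fun q => F (snd q) * C q) p
  - 1 / 2 * partial_x Z (partial_x Z (fun q => D (snd q) * C q)) p.

Lemma DC_x p : Z p -> partial_x Z (fun q => D (snd q) * C q) p
  = Dn 1%nat (snd p) * C p + D (snd p) * (cx (fst p, Q p) * r p).
Proof.
intros Zp; assert (HQ := Qs p Zp); assert (Hx : 0 < snd p) by lra.
rewrite (partial_x_eq Z Z2 _ p _ _ Zp (taylor_mult Z _ _ p _ _ _ _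
  (of_x_taylor D p _ (HD 0%nat _ Hx)) (C_taylor p Zp))).
ring.
Qed.

Lemma DC_xx p : Z p -> partial_x Z (partial_x Z (fun q => D (snd q) * C q)) p
  = Dn 2%nat (snd p) * C p + 2 * Dn 1%nat (snd p) * (cx (fst p, Q p) * r p)
    + D (snd p) * (cxx (fst p, Q p) * r p ^ 2 + cx (fst p, Q p) * r_x p).
Proof.
intros Zp; assert (HQ := Qs p Zp); assert (Hx : 0 < snd p) by lra.
destruct (r_taylor p Zp) as [a Hr].
assert (Hcx' := along_taylor cx p _ _ Zp (Hcx _ (proj1 Zp : half_plane (fst p, Q p)))).
assert (H1 := taylor_mult Z _ _ p _ _ _ _
  (of_x_taylor (Dn 1%nat) p _ (HD 1%nat _ Hx)) (C_taylor p Zp)).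
assert (H2 := taylor_mult Z _ _ p _ _ _ _
  (of_x_taylor D p _ (HD 0%nat _ Hx)) (taylor_mult Z _ _ p _ _ _ _ Hcx' Hr)).
assert (H := taylor_plus Z _ _ p _ _ _ _ H1 H2).
apply taylor_ext with (g := partial_x Z (fun q => D (snd q) * C q)) in H;
  [|exact Zp|intros q Zq; symmetry; apply DC_x, Zq].
rewrite (partial_x_eq Z Z2 _ p _ _ Zp H); ring.
Qed.

(** The last factor is [D(Q) - D(x) r ^ 2], written with increments of [D] and [F]
  over [[Q, x]]. *)
Lemma remainder_eq p : Z p ->
  ct (fst p, Q p) = 1 / 2 * D (Q p) * cxx (fst p, Q p) ->
  remainder p =
    Fn 1%nat (snd p) * C p
    - 1 / 2 * (Dn 2%nat (snd p) * C p)
    - Dn 1%nat (snd p) * (cx (fst p, Q p) * r p)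
    - 1 / 2 * (D (snd p) / F (snd p) * (cx (fst p, Q p) * r p)
        * (Fn 1%nat (Q p) - Fn 1%nat (snd p)))
    + 1 / 2 * (cxx (fst p, Q p) * (D (Q p) - D (snd p)
        + D (snd p) / F (snd p) * (1 + r p) * (F (snd p) - F (Q p)))).
Proof.
intros Zp Hpde; assert (HQ := Qs p Zp); assert (Hx : 0 < snd p) by lra.
assert (HFx : 0 < F (snd p)) by (apply Fpos; lra).
unfold remainder; rewrite (DC_xx p Zp).
rewrite (partial_t_eq Z Z2 C p _ _ Zp (C_taylor p Zp)).
rewrite (partial_x_eq Z Z2 _ p _ _ Zp (taylor_mult Z _ _ p _ _ _ _
  (of_x_taylor F p _ (HF 0%nat _ Hx)) (C_taylor p Zp))).
rewrite Hpde; unfold r_x, r; field; lra.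
Qed.

Variables gamma A0 A1 A2 Kp L B B1 B2 : R.
Hypothesis Hgamma : 0 <= gamma <= 1 / 2.
Hypothesis HA0 : forall x, M <= x -> 0 <= D x <= A0 * F x.
Hypothesis HF1 : forall x, M <= x -> Rabs (Fn 1%nat x) <= A1 * Rpower x (gamma - 1).
Hypothesis HD1 : forall x, M <= x -> Rabs (Dn 1%nat x) <= A1 * Rpower x (gamma - 1).
Hypothesis HD2 : forall x, M <= x -> Rabs (Dn 2%nat x) <= A2 * Rpower x (gamma - 1).
Hypothesis HKp : forall x, M <= x -> F x <= Kp * Rpower x gamma.
Hypothesis HL : forall x, M <= x -> F x <= L * x.
Hypothesis HB : forall p, half_plane p -> Rabs (c p) <= B.
Hypothesis HB1 : forall t x, 0 <= t -> M <= x -> Rabs (cx (t, x)) <= B1.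
Hypothesis HB2 : forall t x, 0 <= t -> M <= x ->
  Rabs (cxx (t, x)) <= B2 * Rpower x (- gamma).

Lemma Rpower_nonincr x y e : 0 < x -> x <= y -> e <= 0 -> Rpower y e <= Rpower x e.
Proof.
intros Hx Hxy He; replace e with (- (- e)) by ring.
rewrite !(Rpower_Ropp _ (- e)); apply Rinv_le_contravar; [apply exp_pos|].
apply Rle_Rpower_l; lra.
Qed.

Lemma Rpower_pred x e : 0 < x -> Rpower x e = x * Rpower x (e - 1).
Proof.
intros Hx; rewrite <- (Rpower_1 x) at 2 by exact Hx; rewrite <- Rpower_plus.
f_equal; ring.
Qed.

(** Comparable arguments have comparable powers, for the two exponents in use. *)
Lemma Rpower_comparable q x k : 0 < q -> q <= x -> x <= q * k ->
  Rpower q (gamma - 1) <= k * Rpower x (gamma - 1)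
  /\ Rpower q (- gamma) <= k * Rpower x (- gamma).
Proof.
intros Hq Hqx Hk.
assert (Hpx : 0 < Rpower x (gamma - 1)) by apply exp_pos.
assert (Hpq : 0 < Rpower q (gamma - 1)) by apply exp_pos.
assert (E : Rpower q gamma <= Rpower x gamma) by (apply Rle_Rpower_l; lra).
assert (E' : Rpower x (gamma - 1) <= Rpower q (gamma - 1))
  by (apply Rpower_nonincr; lra).
split.
- rewrite (Rpower_pred q gamma), (Rpower_pred x gamma) in E by lra.
  apply Rmult_le_reg_l with q; [exact Hq|]; nra.
- rewrite !Rpower_Ropp.
  assert (Hx0 : 0 < Rpower x gamma) by apply exp_pos.
  assert (Hq0 : 0 < Rpower q gamma) by apply exp_pos.
  assert (Rpower x gamma <= k * Rpower q gamma).
  { rewrite (Rpower_pred q gamma), (Rpower_pred x gamma) by lra; nra. }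
  apply Rmult_le_reg_l with (Rpower q gamma); [exact Hq0|].
  rewrite Rinv_r by lra.
  apply Rmult_le_reg_r with (Rpower x gamma); [exact Hx0|].
  replace (Rpower q gamma * (k * / Rpower x gamma) * Rpower x gamma)
    with (k * Rpower q gamma) by (field; lra); lra.
Qed.

Lemma Rabs_mult_le a b u v : Rabs a <= u -> Rabs b <= v -> Rabs (a * b) <= u * v.
Proof.
intros Hu Hv; rewrite Rabs_mult; apply Rmult_le_compat; auto using Rabs_pos.
Qed.

Lemma increment_bound (fn : nat -> R -> R) q x : derivatives_pos fn ->
  (forall y, M <= y -> Rabs (fn 1%nat y) <= A1 * Rpower y (gamma - 1)) ->
  M <= q -> q <= x ->
  Rabs (fn 0%nat x - fn 0%nat q) <= A1 * Rpower q (gamma - 1) * (x - q).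
Proof.
intros Hfn H1 Hq Hqx.
destruct (MVT_gen (fn 0%nat) q x (fn 1%nat)) as (z & Hz & E).
- rewrite Rmin_left by lra; intros y Hy; apply Hfn; lra.
- rewrite Rmin_left by lra; intros y Hy; apply derivable_continuous_pt.
  exists (fn 1%nat y); apply is_derive_Reals, Hfn; lra.
- rewrite Rmin_left, Rmax_right in Hz by lra.
  rewrite E; apply Rabs_mult_le; [|rewrite Rabs_pos_eq; lra].
  apply Rle_trans with (1 := H1 z ltac:(lra)).
  assert (0 < Rpower M (gamma - 1)) by apply exp_pos.
  assert (HA1 : 0 <= A1)
    by (generalize (H1 M (Rle_refl M)) (Rabs_pos (fn 1%nat M)); intros; nra).
  apply Rmult_le_compat_l; [exact HA1|]; apply Rpower_nonincr; lra.
Qed.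

Let K0 := A1 * B + A2 * B + A1 * B1 + 2 * A0 * B1 * A1
          + B2 * (1 + 2 * A0) * A1 * Kp.

Lemma remainder_bound p : Z p ->
  ct (fst p, Q p) = 1 / 2 * D (Q p) * cxx (fst p, Q p) ->
  Rabs (remainder p)
  <= K0 * (1 + fst p) * exp (2 * L * fst p) * Rpower (snd p) (gamma - 1)
  /\ 0 <= K0.
Proof.
intros Zp Hpde; assert (HQ := proj1 (Qs p Zp)).
rewrite (remainder_eq p Zp Hpde).
assert (Ht : 0 <= fst p) by exact (proj1 Zp).
assert (Hcomp := Q_comparable Fn M HF HM Fpos L p HL Zp).
assert (Hdist := Q_distance Fn M HF HM Fpos Fincr p Zp).
fold F Q in Hcomp, Hdist.
assert (HBp := HB (fst p, Q p) Ht : Rabs (C p) <= B).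
assert (HB1p := HB1 (fst p) (Q p) Ht ltac:(lra)).
assert (HB2p := HB2 (fst p) (Q p) Ht ltac:(lra)).
assert (HincF := increment_bound Fn (Q p) (snd p) HF HF1 ltac:(lra) ltac:(lra)).
assert (HincD := increment_bound Dn (Q p) (snd p) HD HD1 ltac:(lra) ltac:(lra)).
fold F in HincF; fold D in HincD.
assert (HF1x := HF1 (snd p) ltac:(lra)); assert (HF1q := HF1 (Q p) ltac:(lra)).
assert (HD1x := HD1 (snd p) ltac:(lra)); assert (HD2x := HD2 (snd p) ltac:(lra)).
assert (HKpx := HKp (snd p) ltac:(lra)).
assert (HDx := HA0 (snd p) ltac:(lra)).
assert (HFx := Fpos (snd p) ltac:(lra)); assert (HFq := Fpos (Q p) ltac:(lra)).
assert (HFle := Fincr (Q p) (snd p) ltac:(lra) ltac:(lra)).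
set (x := snd p) in *; set (q := Q p) in *; set (t := fst p) in *.
assert (HLpos : 0 <= L) by (generalize (HL x ltac:(lra)); nra).
set (k := exp (L * t)) in *.
assert (Hk : 1 <= k).
{ unfold k; generalize (exp_ineq1_le (L * t)); nra. }
destruct (Rpower_comparable q x k) as [Hk1 Hk2]; [lra|lra|exact Hcomp|].
assert (Ek : exp (2 * L * t) = k * k).
{ unfold k; rewrite <- exp_plus; f_equal; ring. }
rewrite Ek.
set (X := Rpower x (gamma - 1)) in *.
assert (HX : 0 < X) by apply exp_pos.
assert (HB0 : 0 <= B) by (generalize (Rabs_pos (C p)); lra).
assert (HB10 : 0 <= B1) by (generalize (Rabs_pos (cx (t, q))); lra).
assert (HB20 : 0 <= B2).
{ assert (0 < Rpower q (- gamma)) by apply exp_pos.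
  generalize (Rabs_pos (cxx (t, q))); nra. }
assert (HA10 : 0 <= A1) by (generalize (Rabs_pos (Fn 1%nat x)); nra).
assert (HA20 : 0 <= A2) by (generalize (Rabs_pos (Dn 2%nat x)); nra).
assert (HA00 : 0 <= A0) by nra.
assert (HKp0 : 0 <= Kp).
{ assert (0 < Rpower x gamma) by apply exp_pos; nra. }
assert (HC0 : 0 <= K0).
{ unfold K0; repeat apply Rplus_le_le_0_compat; repeat apply Rmult_le_pos; lra. }
split; [|exact HC0].
assert (HDF : Rabs (D x / F x) <= A0).
{ rewrite Rabs_pos_eq; [apply Rle_div_l; lra|].
  apply Rmult_le_pos; [lra|apply Rlt_le, Rinv_0_lt_compat, HFx]. }
assert (Hr0 : 0 <= r p <= 1).
{ unfold r; fold q x; split.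
  - apply Rmult_le_pos; [lra|apply Rlt_le, Rinv_0_lt_compat, HFx].
  - apply Rle_div_l; lra. }
assert (Hr1 : Rabs (r p) <= 1) by (rewrite Rabs_pos_eq; lra).
assert (Hcr := Rabs_mult_le _ _ _ _ HB1p Hr1); rewrite Rmult_1_r in Hcr.
assert (HkX : X <= k * X) by nra.
assert (T1 : Rabs (Fn 1%nat x * C p) <= A1 * B * X).
{ apply Rle_trans with (1 := Rabs_mult_le _ _ _ _ HF1x HBp); right; ring. }
assert (T2 : Rabs (Dn 2%nat x * C p) <= A2 * B * X).
{ apply Rle_trans with (1 := Rabs_mult_le _ _ _ _ HD2x HBp); right; ring. }
assert (T3 : Rabs (Dn 1%nat x * (cx (t, q) * r p)) <= A1 * B1 * X).
{ apply Rle_trans with (1 := Rabs_mult_le _ _ _ _ HD1x Hcr); right; ring. }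
assert (HF1d : Rabs (Fn 1%nat q - Fn 1%nat x) <= 2 * A1 * (k * X)).
{ unfold Rminus; apply Rle_trans with (1 := Rabs_triang _ _); rewrite Rabs_Ropp; nra. }
assert (T4 : Rabs (D x / F x * (cx (t, q) * r p) * (Fn 1%nat q - Fn 1%nat x))
  <= 2 * A0 * B1 * A1 * (k * X)).
{ apply Rle_trans with (1 := Rabs_mult_le _ _ _ _ (Rabs_mult_le _ _ _ _ HDF Hcr) HF1d).
  right; ring. }
(* both increments over [[q, x]] are of order [x ^ (2 * gamma - 1)] *)
set (I := A1 * (k * X) * (t * (Kp * Rpower x gamma))).
assert (HI : A1 * Rpower q (gamma - 1) * (x - q) <= I).
{ unfold I; apply Rmult_le_compat; [|lra| |].
  - apply Rmult_le_pos; [lra|apply Rlt_le, exp_pos].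
  - apply Rmult_le_compat_l; lra.
  - apply Rle_trans with (1 := Hdist); apply Rmult_le_compat_l; lra. }
assert (HG : Rabs (D q - D x + D x / F x * (1 + r p) * (F x - F q))
  <= (1 + 2 * A0) * I).
{ apply Rle_trans with (1 := Rabs_triang _ _).
  rewrite (Rabs_minus_sym (D q)).
  assert (Rabs (1 + r p) <= 2) by (rewrite Rabs_pos_eq; lra).
  generalize (Rabs_mult_le _ _ _ _ (Rabs_mult_le _ _ _ _ HDF H)
    (Rle_trans _ _ _ HincF HI)); lra. }
assert (T5 : Rabs (cxx (t, q) * (D q - D x + D x / F x * (1 + r p) * (F x - F q)))
  <= B2 * (1 + 2 * A0) * A1 * Kp * (t * (k * k * X))).
{ assert (Hxx : Rabs (cxx (t, q)) <= B2 * (k * Rpower x (- gamma))).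
  { apply Rle_trans with (1 := HB2p); apply Rmult_le_compat_l; lra. }
  apply Rle_trans with (1 := Rabs_mult_le _ _ _ _ Hxx HG).
  assert (Hx0 : 0 < Rpower x gamma) by apply exp_pos.
  unfold I; rewrite Rpower_Ropp; right; field; lra. }
assert (Hkk : k * X <= k * k * X) by nra.
assert (S1 : A1 * B * X <= A1 * B * (k * k * X))
  by (apply Rmult_le_compat_l; [apply Rmult_le_pos|]; lra).
assert (S2 : A2 * B * X <= A2 * B * (k * k * X))
  by (apply Rmult_le_compat_l; [apply Rmult_le_pos|]; lra).
assert (S3 : A1 * B1 * X <= A1 * B1 * (k * k * X))
  by (apply Rmult_le_compat_l; [apply Rmult_le_pos|]; lra).
assert (S4 : 2 * A0 * B1 * A1 * (k * X) <= 2 * A0 * B1 * A1 * (k * k * X))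
  by (apply Rmult_le_compat_l; [repeat apply Rmult_le_pos|]; lra).
set (Y := k * k * X) in *.
assert (HY : 0 < Y) by (unfold Y; nra).
set (K1 := A1 * B + A2 * B + A1 * B1 + 2 * A0 * B1 * A1).
set (K2 := B2 * (1 + 2 * A0) * A1 * Kp).
assert (HK1 : 0 <= K1).
{ unfold K1; repeat apply Rplus_le_le_0_compat; repeat apply Rmult_le_pos; lra. }
assert (HK2 : 0 <= K2) by (unfold K2; repeat apply Rmult_le_pos; lra).
apply Rle_trans with (K1 * Y + K2 * (t * Y)).
- assert (T5' := Rle_trans _ _ _ T5 (Rle_refl (K2 * (t * Y)))).
  clear T5; unfold K1.
  apply Rabs_le_between in T1, T2, T3, T4, T5'; apply Rabs_le_between; lra.
- replace (K0 * (1 + t) * (k * k) * X) with ((K1 + K2) * (1 + t) * Y)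
    by (unfold K0, K1, K2, Y; ring).
  assert (0 <= K1 * (t * Y)) by (repeat apply Rmult_le_pos; lra).
  assert (0 <= K2 * Y) by (repeat apply Rmult_le_pos; lra).
  lra.
Qed.

End Remainder.

(** * From the assumptions to derivatives and bounds on [[M, +oo)] *)

(** At interior points the derivatives relative to [S] are the usual ones. *)
Lemma is_derive_on_interior (S : R -> Prop) (f : R -> R) (x l : R) :
  locally x S -> is_derive_on S f x l <-> is_derive f x l.
Proof.
intros HS.
assert (Sx : S x) by exact (locally_singleton _ _ HS).
split; intros [H1 H2]; split; try exact H1; intros y Hy eps.
- assert (Hw : is_filter_lim (within S (locally x)) y).
  { intros P HP; unfold within; apply filter_imp with (2 := Hy P HP); auto. }
  generalize (filter_and _ _ HS (H2 y Hw eps)).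
  apply filter_imp; intros z [Hz1 Hz2]; apply Hz2, Hz1.
- assert (Hw : is_filter_lim (locally x) y).
  { intros P HP; generalize (filter_and _ _ HS (Hy P HP)).
    apply filter_imp; intros z [Hz1 Hz2]; apply Hz2, Hz1. }
  unfold within; apply filter_imp with (2 := H2 y Hw eps); auto.
Qed.

Lemma smooth_on_derivatives_pos f : smooth_on Rplus_set f ->
  derivatives_pos (Derive_n_on Rplus_set f).
Proof.
intros H n x Hx.
assert (HS : locally x Rplus_set).
{ exists (mkposreal x Hx); intros y Hy; unfold Rplus_set.
  unfold ball in Hy; simpl in Hy; unfold AbsRing_ball, abs, minus, plus, opp in Hy.
  simpl in Hy; apply Rabs_def2 in Hy; lra. }
destruct (H n x (Rlt_le _ _ Hx)) as [l Hl].
apply is_derive_on_interior in Hl; [|exact HS].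
replace (Derive_n_on Rplus_set f (S n) x) with l; [exact Hl|].
symmetry; apply (@iota_unique R_AbsRing R_CompleteNormedModule).
- intros y Hy; apply is_derive_on_interior in Hy; [|exact HS].
  rewrite <- (is_derive_unique _ _ _ Hl); symmetry; apply is_derive_unique, Hy.
- apply is_derive_on_interior; assumption.
Qed.

(** An estimate at infinity extends to [[M, +oo)] by continuity on a compact interval. *)
Lemma bigO_bound (g g' : R -> R) (e M : R) : 0 < M ->
  (forall x, 0 < x -> is_derive g x (g' x)) ->
  bigO_infty g (fun x => Rpower x e) ->
  exists A, 0 <= A /\ forall x, M <= x -> Rabs (g x) <= A * Rpower x e.
Proof.
intros HM Hg [A [N HA]].
set (h := fun x => Rabs (g x * Rpower x (- e))).
destruct (continuity_ab_maj h M (Rmax M (N + 1))) as (xm & Hxm & _).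
- apply Rmax_l.
- intros x Hx; apply continuity_pt_filterlim.
  apply (continuous_comp (fun x => g x * Rpower x (- e)) Rabs).
  + apply (ex_derive_continuous (fun x => g x * Rpower x (- e))).
    apply ex_derive_mult.
    * exists (g' x); apply Hg; lra.
    * unfold Rpower; auto_derive; lra.
  + apply continuous_Rabs.
- exists (Rmax (Rmax A 0) (h xm)); split.
  + apply Rle_trans with (Rmax A 0); [apply Rmax_r|apply Rmax_l].
  + intros x Hx; assert (He : 0 < Rpower x e) by apply exp_pos.
    destruct (Rle_dec x (Rmax M (N + 1))) as [Hle|Hgt].
    * apply Rle_trans with (h xm * Rpower x e);
        [|apply Rmult_le_compat_r; [lra|apply Rmax_r]].
      apply Rle_trans with (h x * Rpower x e);
        [|apply Rmult_le_compat_r; [lra|apply Hxm; lra]].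
      unfold h; rewrite Rabs_mult, Rpower_Ropp, (Rabs_pos_eq (/ _))
        by (apply Rlt_le, Rinv_0_lt_compat, exp_pos).
      right; field; lra.
    * generalize (Rmax_r M (N + 1)); intros.
      apply Rle_trans with (1 := HA x ltac:(lra)).
      rewrite (Rabs_pos_eq (Rpower x e)) by lra.
      apply Rmult_le_compat_r; [lra|].
      apply Rle_trans with (Rmax A 0); apply Rmax_l.
Qed.

Lemma rate_function_bound gamma a M : 0 < M -> rate_function gamma a ->
  exists A, 0 <= A /\ forall k x, (k <= 2)%nat -> M <= x ->
    Rabs (Derive_n_on Rplus_set a k x) <= A * Rpower x (gamma - INR k).
Proof.
intros HM (Hs & _ & _ & HO).
assert (HD := smooth_on_derivatives_pos a Hs).
destruct (bigO_bound _ _ _ M HM (HD 0%nat) (HO 0%nat ltac:(lia))) as (A0 & H0 & K0).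
destruct (bigO_bound _ _ _ M HM (HD 1%nat) (HO 1%nat ltac:(lia))) as (A1 & H1 & K1).
destruct (bigO_bound _ _ _ M HM (HD 2%nat) (HO 2%nat ltac:(lia))) as (A2 & H2 & K2).
exists (A0 + A1 + A2); split; [lra|]; intros k x Hk Hx.
assert (Hp : 0 < Rpower x (gamma - INR k)) by apply exp_pos.
assert (Hk' : k = 0%nat \/ k = 1%nat \/ k = 2%nat) by lia.
destruct Hk' as [->|[->| ->]].
- apply Rle_trans with (1 := K0 x Hx), Rmult_le_compat_r; lra.
- apply Rle_trans with (1 := K1 x Hx), Rmult_le_compat_r; lra.
- apply Rle_trans with (1 := K2 x Hx), Rmult_le_compat_r; lra.
Qed.

Lemma derivatives_pos_F (a b : nat -> R -> R) (k : R) :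
  derivatives_pos a -> derivatives_pos b ->
  derivatives_pos (fun n x => b n x * k - a n x).
Proof.
intros Ha Hb n x Hx; apply (is_derive_minus (V := R_NormedModule)).
- apply is_derive_ext with (fun y => k * b n y); [intros; apply Rmult_comm|].
  rewrite Rmult_comm; apply is_derive_scal, Hb, Hx.
- apply Ha, Hx.
Qed.

Lemma derivatives_pos_D (a b : nat -> R -> R) (k : R) :
  derivatives_pos a -> derivatives_pos b ->
  derivatives_pos (fun n x => b n x * k + a n x).
Proof.
intros Ha Hb n x Hx; apply (is_derive_plus (V := R_NormedModule)).
- apply is_derive_ext with (fun y => k * b n y); [intros; apply Rmult_comm|].
  rewrite Rmult_comm; apply is_derive_scal, Hb, Hx.
- apply Ha, Hx.
Qed.

(** Quadratic growth of [sigma ^ 2 / 2], as the minimum principle requires; already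
  [gamma / 2 <= 1] suffices. *)
Lemma sigma_bound gamma sigma sigma0 sigmab : 0 <= gamma <= 1 / 2 ->
  diffusion_assumption gamma sigma sigma0 sigmab ->
  exists A, 0 <= A /\ forall q, 0 <= 1 / 2 * sigma q ^ 2 <= A * (1 + q ^ 2).
Proof.
intros Hg H; destruct (sigmab_bounds _ _ _ _ H) as (dm & dp & Hdm & Hdp & Hb).
destruct (continuity_ab_maj sigma (-1) 1) as (q0 & Hq0 & _); [lra| |].
{ intros q _; apply continuity_pt_filterlim.
  apply (ex_derive_continuous sigma), (sigma_smooth _ _ _ _ H 1%nat). }
assert (Hpos := sigma_pos _ _ _ _ H).
exists (sigma q0 ^ 2 + dp ^ 2); split; [nra|]; intros q; split.
{ generalize (pow2_ge_0 (sigma q)); lra. }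
assert (Hq2 : 0 <= q ^ 2) by apply pow2_ge_0.
destruct (Rle_dec 1 (Rabs q)) as [Hq|Hq].
- assert (sigma q <= Rabs q * dp).
  { rewrite (sigma_factor _ _ _ _ H); apply Rmult_le_compat.
    - rewrite (sigma0_power _ _ _ _ H) by exact Hq; apply Rlt_le, exp_pos.
    - generalize (Hb q); lra.
    - rewrite (sigma0_power _ _ _ _ H) by exact Hq.
      rewrite <- (Rpower_1 (Rabs q)) at 2 by lra.
      apply Rle_Rpower; lra.
    - apply Hb. }
  assert (sigma q ^ 2 <= (Rabs q * dp) ^ 2).
  { apply pow_incr; generalize (Hpos q); lra. }
  rewrite Rpow_mult_distr, pow2_abs in H1.
  generalize (pow2_ge_0 (sigma q0)) (pow2_ge_0 dp) (pow2_ge_0 (sigma q)); nra.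
- assert (Hs : sigma q <= sigma q0).
  { apply Hq0; apply Rabs_le_between; lra. }
  assert (sigma q ^ 2 <= sigma q0 ^ 2).
  { apply pow_incr; generalize (Hpos q); lra. }
  generalize (pow2_ge_0 (sigma q0)) (pow2_ge_0 dp) (pow2_ge_0 (sigma q)); nra.
Qed.

(** [sigma] and [sigma0] are comparable, so the weighted bound on the second
  derivative of [c0] is one on [sigma ^ 2 c0'' / 2]. *)
Lemma initial_bound gamma sigma sigma0 sigmab c0 :
  diffusion_assumption gamma sigma sigma0 sigmab -> initial_assumption sigma0 c0 ->
  exists A, forall q, Rabs (1 / 2 * sigma q ^ 2 * Derive_n c0 2 q) <= A.
Proof.
intros H H0; destruct (sigmab_bounds _ _ _ _ H) as (dm & dp & Hdm & Hdp & Hb).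
destruct (c0_weighted _ _ H0 2%nat ltac:(lia)) as (R2 & HR0 & HR).
exists (dp ^ 2 * R2); intros q; rewrite (sigma_factor _ _ _ _ H).
replace (1 / 2 * (sigma0 q * sigmab q) ^ 2 * Derive_n c0 2 q)
  with ((1 / 2 * sigmab q ^ 2) * (Derive_n c0 2 q * sigma0 q ^ 2)) by ring.
apply Rabs_mult_le; [|apply HR].
assert (sigmab q ^ 2 <= dp ^ 2) by (apply pow_incr; generalize (Hb q); lra).
generalize (pow2_ge_0 (sigmab q)); intros; rewrite Rabs_pos_eq; lra.
Qed.

Theorem theorem12 :
  forall (C1 : R) (alpha beta : R -> R) (gamma M : R)
    (sigma sigma0 sigmab c0 : R -> R) (c : R * R -> R),
  0 <= C1 ->
  rates_assumption C1 alpha beta gamma M ->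
  diffusion_assumption gamma sigma sigma0 sigmab ->
  (forall q, M <= q -> sigma q ^ 2 = Dfun C1 alpha beta q) ->
  initial_assumption sigma0 c0 ->
  bounded_smooth_solution sigma c0 c ->
  let F := Ffun C1 alpha beta in
  let D := Dfun C1 alpha beta in
  let Z := Zdom F M in
  let C := fun p : R * R => c (fst p, Qfun F M p) in
  smooth2_on Z C /\
  exists Rem : R * R -> R,
    (forall p, Z p ->
       partial_t Z C p
       = - partial_x Z (fun p' => F (snd p') * C p') p
         + 1 / 2 * partial_x Z (partial_x Z (fun p' => D (snd p') * C p')) p
         + Rem p)
    /\ exists K : R -> R,
         continuous_on Rplus_set K
         /\ (forall t, 0 <= t -> 0 <= K t)
         /\ (forall t x, Z (t, x) ->
               Rabs (Rem (t, x)) <= K t * Rpower x (gamma - 1)).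
Proof.
intros C1 alpha beta gamma M sigma sigma0 sigmab c0 c HC1 Hrates Hdiff HsD Hinit Hsol
  F D Z C.
destruct Hrates as [Hg Ha Hb HM Fpos Fincr (Km & Kp & HKm & HKp & Hgrow)].
set (an := Derive_n_on Rplus_set alpha); set (bn := Derive_n_on Rplus_set beta).
set (Fn := fun (n : nat) x => bn n x * C1 - an n x).
set (Dn := fun (n : nat) x => bn n x * C1 + an n x).
assert (Dan : derivatives_pos an) by apply smooth_on_derivatives_pos, Ha.
assert (Dbn : derivatives_pos bn) by apply smooth_on_derivatives_pos, Hb.
assert (HF : derivatives_pos Fn) by (apply derivatives_pos_F; assumption).
assert (HD : derivatives_pos Dn) by (apply derivatives_pos_D; assumption).
assert (Fincr' : forall x y, M <= x -> x <= y -> F x <= F y).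
{ intros x y Hx [Hxy| ->]; [left; apply Fincr; assumption|right; reflexivity]. }
(* growth of [F], [D] and their derivatives *)
destruct (rate_function_bound gamma alpha M HM Ha) as (Aa & HAa & Ka).
destruct (rate_function_bound gamma beta M HM Hb) as (Ab & HAb & Kb).
fold an in Ka; fold bn in Kb.
set (A1 := Ab * C1 + Aa).
assert (HA1 : 0 <= A1) by (unfold A1; nra).
assert (KF : forall k x, (k <= 2)%nat -> M <= x ->
  Rabs (Fn k x) <= A1 * Rpower x (gamma - INR k)
  /\ Rabs (Dn k x) <= A1 * Rpower x (gamma - INR k)).
{ intros k x Hk Hx; specialize (Ka k x Hk Hx); specialize (Kb k x Hk Hx).
  assert (Kb' : Rabs (bn k x * C1) <= Ab * Rpower x (gamma - INR k) * C1).
  { apply Rabs_mult_le; [exact Kb|rewrite Rabs_pos_eq; lra]. }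
  unfold Fn, Dn, A1, Rminus at 1; split.
  - apply Rle_trans with (1 := Rabs_triang _ _); rewrite Rabs_Ropp; lra.
  - apply Rle_trans with (1 := Rabs_triang _ _); lra. }
assert (HX2 : forall x, M <= x -> Rpower x (gamma - 2) <= / M * Rpower x (gamma - 1)).
{ intros x Hx; rewrite (Rpower_pred x (gamma - 1)) by lra.
  replace (gamma - 1 - 1) with (gamma - 2) by ring.
  assert (0 < Rpower x (gamma - 2)) by apply exp_pos.
  apply Rmult_le_reg_l with M; [exact HM|].
  replace (M * (/ M * (x * Rpower x (gamma - 2)))) with (x * Rpower x (gamma - 2))
    by (field; lra).
  apply Rmult_le_compat_r; lra. }
assert (HFD : forall x, M <= x -> F x <= D x).
{ intros x Hx; unfold F, D, Ffun, Dfun.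
  generalize (proj1 (proj2 Ha) x ltac:(lra)); lra. }
set (L := Kp * Rpower M (gamma - 1)).
assert (HL : forall x, M <= x -> F x <= L * x).
{ intros x Hx; apply Rle_trans with (1 := proj2 (Hgrow x Hx)).
  rewrite (Rpower_pred x gamma) by lra.
  assert (Rpower x (gamma - 1) <= Rpower M (gamma - 1)) by (apply Rpower_nonincr; lra).
  unfold L; rewrite Rmult_assoc; apply Rmult_le_compat_l; [lra|].
  rewrite (Rmult_comm _ x); apply Rmult_le_compat_l; lra. }
(* bounds on [c] *)
destruct (solution_bounded _ _ _ Hsol) as [B HB].
destruct (sigma_bound gamma sigma sigma0 sigmab Hg Hdiff) as (As & _ & Hsigma).
destruct (initial_bound gamma sigma sigma0 sigmab c0 Hdiff Hinit) as (A & HA).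
assert (Hsm := solution_smooth _ _ _ Hsol).
assert (hp2 := half_plane_two_directions).
set (ct := partial_t half_plane c); set (cx := partial_x half_plane c).
set (cxt := partial_t half_plane cx); set (cxx := partial_x half_plane cx).
assert (Hc : forall p, half_plane p -> taylor_on half_plane c p (ct p) (cx p)).
{ intros p Hp; apply (Ck2_taylor 0); [exact hp2|exact Hp|apply Hsm]. }
assert (Hcx : forall p, half_plane p -> taylor_on half_plane cx p (cxt p) (cxx p)).
{ intros p Hp; apply (Ck2_taylor 0); [exact hp2|exact Hp|].
  exact (proj2 (proj2 (Hsm 2%nat))). }
assert (Hpde : forall p, half_plane p -> ct p = 1 / 2 * sigma (snd p) ^ 2 * cxx p)
  by exact (solution_equation _ _ _ Hsol).
assert (Hc0 : forall x, Derive_n c0 2 x = cxx (0, x)).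
{ assert (hp0 : forall x, half_plane (0, x)) by (intros; apply Rle_refl).
  assert (E1 : forall x, Derive c0 x = cx (0, x)).
  { intros x; apply is_derive_unique.
    apply is_derive_ext with (fun y => c (0, y)); [apply (solution_initial _ _ _ Hsol)|].
    apply derive_slice_x with half_plane (ct (0, x)); [exact hp0|apply Hc, hp0]. }
  intros x; change (Derive (Derive c0) x = cxx (0, x)).
  rewrite (Derive_ext _ _ x E1); apply is_derive_unique.
  apply derive_slice_x with half_plane (cxt (0, x)); [exact hp0|apply Hcx, hp0]. }
assert (HA' : forall x, Rabs (1 / 2 * sigma x ^ 2 * cxx (0, x)) <= A)
  by (intros x; rewrite <- Hc0; apply HA).
assert (Hct := time_derivative_bound _ _ _ _ _ _ _ _ _ Hsigma Hc Hcx Hpde HB HA').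
assert (HA0 : 0 <= A)
  by (generalize (HA' 0) (Rabs_pos (1 / 2 * sigma 0 ^ 2 * cxx (0, 0))); lra).
(* the equation turns the bound on [c_t] into a bound on [c_xx] *)
assert (HcF : forall t x, 0 <= t -> M <= x -> Rabs (cxx (t, x)) * F x <= 2 * A).
{ intros t x Ht Hx; generalize (Hct (t, x) Ht).
  rewrite (Hpde (t, x) Ht); simpl snd; rewrite (HsD x Hx); fold D.
  assert (HFx := Fpos x Hx); assert (HDx := HFD x Hx); fold F in HFx.
  rewrite Rabs_mult, (Rabs_pos_eq (1 / 2 * D x)) by lra.
  generalize (Rabs_pos (cxx (t, x))); intros; nra. }
set (B2 := 2 * A / Km).
assert (HB2 : forall t x, 0 <= t -> M <= x ->
  Rabs (cxx (t, x)) <= B2 * Rpower x (- gamma)).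
{ intros t x Ht Hx; specialize (HcF t x Ht Hx).
  assert (Hp : 0 < Rpower x gamma) by apply exp_pos.
  assert (HFx := proj1 (Hgrow x Hx)); fold F in HFx.
  assert (0 < Km * Rpower x gamma) by (apply Rmult_lt_0_compat; assumption).
  replace (B2 * Rpower x (- gamma)) with (2 * A / (Km * Rpower x gamma))
    by (unfold B2; rewrite Rpower_Ropp; field; lra).
  apply Rle_div_r; [assumption|].
  apply Rle_trans with (2 := HcF); apply Rmult_le_compat_l; [apply Rabs_pos|exact HFx]. }
set (B1 := 2 * B + 2 * A / F M).
assert (HB1 : forall t x, 0 <= t -> M <= x -> Rabs (cx (t, x)) <= B1).
{ intros t x Ht Hx; apply (space_derivative_bound B c ct cx cxt cxx Hc Hcx HB);
    [exact Ht|].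
  intros y Hy; assert (HFM := Fpos M (Rle_refl M)); fold F in HFM.
  apply Rle_div_r; [exact HFM|].
  apply Rle_trans with (2 := HcF t y Ht ltac:(lra)).
  apply Rmult_le_compat_l; [apply Rabs_pos|apply Fincr'; lra]. }
split.
- intros k; apply class_C_Ck2.
  + exact (Z_two_directions Fn M HF HM Fpos Fincr').
  + apply (class_C_C Fn M HF HM Fpos Fincr' c k), Ck2_class_C; [exact hp2|apply Hsm].
- set (Rem := remainder Fn Dn M c).
  assert (Hrem : exists K0, forall p, Z p ->
    Rabs (Rem p) <= K0 * (1 + fst p) * exp (2 * L * fst p) * Rpower (snd p) (gamma - 1)
    /\ 0 <= K0).
  { eexists; intros p Zp.
    apply (remainder_bound Fn Dn M HF HD HM Fpos Fincr' c ct cx cxt cxx Hc Hcx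
      gamma (A1 / Km) A1 (A1 / M) Kp L B B1 B2 Hg); try assumption.
    - intros x Hx; assert (HFx := Fpos x Hx); fold F in HFx.
      assert (HDx := HFD x Hx); split; [change (0 <= D x); lra|].
      assert (K := proj2 (KF 0%nat x ltac:(lia) Hx)); simpl INR in K.
      rewrite Rminus_0_r in K.
      apply Rle_trans with (1 := Rle_abs _), Rle_trans with (1 := K).
      assert (HFx' := proj1 (Hgrow x Hx)); fold F in HFx'.
      replace (A1 * Rpower x gamma) with (A1 / Km * (Km * Rpower x gamma))
        by (field; lra).
      apply Rmult_le_compat_l; [|exact HFx'].
      apply Rmult_le_pos; [exact HA1|apply Rlt_le, Rinv_0_lt_compat, HKm].
    - intros x Hx; apply (proj1 (KF 1%nat x ltac:(lia) Hx)).
    - intros x Hx; apply (proj2 (KF 1%nat x ltac:(lia) Hx)).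
    - intros x Hx; apply Rle_trans with (1 := proj2 (KF 2%nat x ltac:(lia) Hx)).
      unfold Rdiv; rewrite Rmult_assoc; apply Rmult_le_compat_l; [exact HA1|].
      apply HX2, Hx.
    - intros x Hx; apply Hgrow, Hx.
    - assert (HQ := Q_spec Fn M HF HM Fpos p Zp).
      rewrite (Hpde (fst p, _) (proj1 Zp)); simpl snd.
      rewrite HsD; [reflexivity|apply HQ]. }
  destruct Hrem as [K0 HK0].
  exists Rem; split.
  + intros p Zp.
    change (Rem p) with (partial_t Z C p + partial_x Z (fun q => F (snd q) * C q) p
      - 1 / 2 * partial_x Z (partial_x Z (fun q => D (snd q) * C q)) p).
    ring.
  + exists (fun t => Rabs K0 * (1 + t) * exp (2 * L * t)); split; [|split].
    * intros t _; apply (filterlim_filter_le_1 (F := locally t)).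
      { intros P HP; unfold within; apply filter_imp with (2 := HP); auto. }
      apply (ex_derive_continuous (fun t => Rabs K0 * (1 + t) * exp (2 * L * t))).
      auto_derive; exact I.
    * intros t Ht; repeat apply Rmult_le_pos;
        [apply Rabs_pos|lra|apply Rlt_le, exp_pos].
    * intros t x Zp; destruct (HK0 (t, x) Zp) as [H1 H2]; simpl in H1.
      rewrite (Rabs_pos_eq K0) by exact H2; exact H1.
Qed.
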